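(* Let $n\ge 3$, let $(M^n,c,W)$ be a conformal manifold with a CSpin structure and a Weyl structure $W$, let $w\in\mathbb{R}$, and let $\psi\in\Gamma(S^w)$ be a twistor spinor, i.e. $\nabla^S_X\psi+\frac1n X\cdot\mathcal{D}\psi=0$ for all vector fields $X$. Suppose the term $$\left(w-\frac12\right)\left(\mu^2F+\frac{1}{2(n-1)}\nu\mu F\right)\psi$$ reduces to a single Clifford product or vanishes, i.e. there is a (real, possibly zero) section $B$ of $T^*\otimes T^*$ such that for all vector fields $X$ $$\left(w-\frac12\right)\left(\sum_jF(X,e_j)e_j\cdot\psi+\frac{1}{2(n-1)}X\cdot F\cdot\psi\right)=\sum_jB(X,e_j)e_j\cdot\psi .$$ (For example, this is satisfied if $w=\frac12$ or if $F\cdot\psi=0$.) Then the sections $$C(\psi):=\mathrm{Re}(\psi,\mathcal{D}\psi)\in\Gamma(\mathcal{L}^{2w-1})$$ and $$Q(\psi):=|\psi|^2|\mathcal{D}\psi|^2-\sum_i\big(\mathrm{Re}(\mathcal{D}\psi,e_i\cdot\psi)\big)^2\in\Gamma(\mathcal{L}^{4w-2})$$ are $W$-parallel, i.e. $\nabla C(\psi)=0$ and $\nabla Q(\psi)=0$.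
   Context: Setting. $M^n$ is a smooth oriented manifold, $c$ a conformal class of Riemannian metrics, $P$ the corresponding bundle of conformal frames with group $CO(n)_+=SO(n)\times\mathbb{R}_+$. $CSpin(n)=Spin(n)\times\mathbb{R}_+$ covers $CO(n)_+$ two-fold via $\lambda^c(a,t)=t\lambda(a)$, where $\lambda:Spin(n)\to SO(n)$ is the covering. A CSpin structure is a principal $CSpin(n)$-bundle $P_{CSpin}$ on $M$ with a two-fold covering $P_{CSpin}\to P$ compatible with $\lambda^c$ and the group actions. Bundles. $\mathcal{L}^w$ is the real line bundle associated to the representation $(a,t)\mapsto t^w$ (densities of weight $w$). A metric $g\in c$ gives $l_g=|vol_g|^{-1/n}\in\Gamma(\mathcal{L}^1)$. $S^w$ is associated to $\kappa^w(a,t)=t^w\kappa(a)$ on $\Delta_n=\mathbb{C}^{2^{[n/2]}}$, with $\kappa$ the spin representation. $T$ (weight $1$) and $T^*$ (weight $-1$) are the ordinary tangent and cotangent bundles. $c=l_g^2g$ is the conformal inner product $T\otimes T\to\mathcal{L}^2$. Throughout $(e_i)$ denotes a local orthonormal frame of the weightless bundle $T\otimes\mathcal{L}^{-1}$, i.e. $e_i=l_g^{-1}\otimes(\text{a } g\text{-orthonormal frame})$, so $c(e_i,e_j)=\delta_{ij}$. Clifford and hermitian product. The Clifford product is induced from $\mathbb{R}^n\otimes\Delta_n\to\Delta_n$ with $x\cdot x=-|x|^2$; weights add: $T\otimes S^w\to S^{w+1}$, $T^*\otimes S^w\to S^{w-1}$, $e_i\cdot:S^w\to S^w$. For a $2$-form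 $F$, $\mu F\psi=F\cdot\psi=\sum_{i,j}F(e_i,e_j)\,e_i\cdot e_j\cdot\psi$ (sum over all $i,j$). For $B\in\Gamma(T^*\otimes T^* )$, $(\mu^2B\psi)(X)=\sum_jB(X,e_j)e_j\cdot\psi$. The operator $\nu$ is $(\nu\psi)(X)=X\cdot\psi$. The conformal hermitian product $(\cdot,\cdot):S^w\otimes S^{w_1}\to\mathbb{C}\otimes\mathcal{L}^{w+w_1}$ is induced by the $Spin(n)$-invariant hermitian product on $\Delta_n$ for which Clifford multiplication by real vectors is skew-hermitian; $|\psi|^2=(\psi,\psi)$. Weyl structure. $W$ is a torsion-free connection on $P$; $\nabla$ is the induced covariant derivative on associated bundles, and $\nabla^S$ that on $S^w$ induced by the lift of $W$. For $g\in c$, $\nabla l_g=\theta\otimes l_g$; the Faraday curvature is $F=d\theta$ (the curvature of $\mathcal{L}^1$, independent of $g$). Dirac operator. $\mathcal{D}:\Gamma(S^w)\to\Gamma(S^{w-1})$, $\mathcal{D}\psi=\sum_i e_i\cdot\nabla^S_{e_i}\psi$. *)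

(* Defs.v *)
From HB Require Import structures.
From mathcomp Require Import all_boot all_order all_algebra.
From mathcomp Require Export complex.
From mathcomp Require Import all_classical all_reals all_analysis.
Set Implicit Arguments.
Unset Strict Implicit.
Unset Printing Implicit Defensive.
Import Order.TTheory GRing.Theory Num.Theory numFieldNormedType.Exports.
Local Open Scope classical_set_scope.
Local Open Scope ring_scope.
Local Open Scope complex_scope.

Section Euclidean.
Variables (R : realType) (n : nat).
Implicit Types (U : set 'rV[R]_n) (f : 'rV[R]_n -> R).

Fixpoint Ck (k : nat) U f : Prop :=
  (forall y, U y -> {for y, continuous f}) /\
  (if k is k'.+1 then
     forall i : 'I_n,
       (forall y, U y -> derivable f y (delta_mx ord0 i)) /\
       Ck k' U (fun y => 'D_(delta_mx ord0 i) f y)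
   else True).

Definition smooth_near f (p : 'rV[R]_n) : Prop :=
  exists2 U, open_nbhs p U & forall k, Ck k U f.
End Euclidean.

Record smooth_manifold (R : realType) (n : nat) := SmoothManifold {
  carrier :> topologicalType;
  manifold_hausdorff : hausdorff_space carrier;
  manifold_second_countable : @second_countable carrier;
  chart_idx : Type;
  chart_dom : chart_idx -> set carrier;
  chart : chart_idx -> carrier -> 'rV[R]_n;
  chart_inv : chart_idx -> 'rV[R]_n -> carrier;
  chart_dom_open : forall i, open (chart_dom i);
  chart_cover : forall x, exists i, chart_dom i x;
  chart_img_open : forall i, open (chart i @` chart_dom i);
  chartK : forall i x, chart_dom i x -> chart_inv i (chart i x) = x;
  chart_continuous :
    forall i x, chart_dom i x -> {for x, continuous (chart i)};
  chart_inv_continuous :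
    forall i x, chart_dom i x -> {for chart i x, continuous (chart_inv i)};
  chart_compat :
    forall i j x a, chart_dom i x -> chart_dom j x ->
      smooth_near (fun y => chart j (chart_inv i y) ord0 a) (chart i x) }.

Section Tangent.
Variables (R : realType) (n : nat) (M : smooth_manifold R n).

Definition smooth_at (f : M -> R) (x : M) : Prop :=
  forall i, chart_dom i x ->
    smooth_near (fun y => f (chart_inv i y)) (chart i x).

(* A tangent vector at x is a derivation of the germs at x of smooth
   functions.  Its value on functions that are not smooth at x is
   normalised to 0, so that Leibniz equality is equality of derivations. *)
Definition tvec := (M -> R) -> R.

Record tangent (x : M) (v : tvec) : Prop := Tangent {
  tangent_linear : forall (a : R) f g, smooth_at f x -> smooth_at g x ->
    v (fun y => a * f y + g y) = a * v f + v g;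
  tangent_leibniz : forall f g, smooth_at f x -> smooth_at g x ->
    v (fun y => f y * g y) = v f * g x + f x * v g;
  tangent_local : forall f g, smooth_at f x -> smooth_at g x ->
    (\near x, f x = g x) -> v f = v g;
  tangent_junk : forall f, ~ smooth_at f x -> v f = 0 }.

Definition vfield := M -> tvec.

Definition smooth_vfield (U : set M) (X : vfield) : Prop :=
  forall x, U x -> tangent x (X x) /\
    forall f, smooth_at f x -> smooth_at (fun y => X y f) x.

Definition bracket (X Y : vfield) : vfield := fun x f =>
  if `[< smooth_at f x >] then X x (fun y => Y y f) - Y x (fun y => X y f)
  else 0.

Definition form1 := M -> tvec -> R.
Definition form2 := M -> tvec -> tvec -> R.

Definition smooth_form1 (U : set M) (t : form1) : Prop :=
  (forall x, U x -> forall (a : R) u v, tangent x u -> tangent x v ->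
     t x (fun f => a * u f + v f) = a * t x u + t x v) /\
  (forall V X, open V -> V `<=` U -> smooth_vfield V X ->
     forall x, V x -> smooth_at (fun y => t y (X y)) x).

(* Sections of T* (x) T*. *)
Definition bilinear_section (B : form2) : Prop :=
  (forall x (a : R) u v w, tangent x u -> tangent x v -> tangent x w ->
     B x (fun f => a * u f + v f) w = a * B x u w + B x v w /\
     B x w (fun f => a * u f + v f) = a * B x w u + B x w v) /\
  (forall U X Y, open U -> smooth_vfield U X -> smooth_vfield U Y ->
     forall x, U x -> smooth_at (fun y => B y (X y) (Y y)) x).

(* F = d t *)
Definition is_ext_deriv (t : form1) (F : form2) : Prop :=
  forall U X Y, open U -> smooth_vfield U X -> smooth_vfield U Y ->
  forall x, U x ->
    F x (X x) (Y x) = X x (fun y => t y (Y y)) - Y x (fun y => t y (X y))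
                      - t x (bracket X Y x).

(** Frames: a frame [e] at x is the isomorphism [vec e] from R^n to T_x M,
    and GL(n) acts on the right by [frame_act]. *)

Definition frame := 'I_n -> tvec.

Definition vec (e : frame) (xi : 'cV[R]_n) : tvec :=
  fun f => \sum_a xi a ord0 * e a f.

Definition frame_act (e : frame) (A : 'M[R]_n) : frame :=
  fun b => vec e (col b A).

Definition is_frame (x : M) (e : frame) : Prop :=
  (forall a, tangent x (e a)) /\
  (forall v, tangent x v -> exists! xi, v = vec e xi).

Definition smooth_frame (U : set M) (p : M -> frame) : Prop :=
  forall a, smooth_vfield U (fun x => p x a).

(* [o x e] means that the frame e at x is positively oriented. *)
Record orientation (o : M -> frame -> Prop) : Prop := Orientation {
  orientation_frame : forall x e, o x e -> is_frame x e;
  orientation_det : forall x e A, o x e -> (o x (frame_act e A) <-> 0 < \det A);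
  orientation_local : forall x, exists U p,
    [/\ open_nbhs x U, smooth_frame U p & forall y, U y -> o y (p y)] }.

Definition riemannian (g : form2) : Prop :=
  [/\ bilinear_section g,
      forall x u v, tangent x u -> tangent x v -> g x u v = g x v u &
      forall x v, tangent x v -> v <> (fun=> 0) -> 0 < g x v v].

Definition conformal_class (c : set form2) : Prop :=
  exists2 g0, riemannian g0 &
    c = [set g | riemannian g /\
           exists u : M -> R,
             (forall x, 0 < u x /\ smooth_at u x) /\
             forall x v w, tangent x v -> tangent x w ->
               g x v w = u x * g0 x v w].

(* The fibre at x of the bundle P of (oriented) conformal frames. *)
Definition conformal_frame (o : M -> frame -> Prop) (c : set form2)
    (x : M) (e : frame) : Prop :=
  o x e /\ exists2 g, c g & exists2 r : R, 0 < r &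
    forall a b, g x (e a) (e b) = r * (a == b)%:R.

Definition d_mx k l (v : tvec) (h : M -> 'M[R]_(k, l)) : 'M[R]_(k, l) :=
  \matrix_(i, j) v (fun y => h y i j).

Definition d_cmx k l (v : tvec) (h : M -> 'M[R[i]]_(k, l)) :
    'M[R[i]]_(k, l) :=
  \matrix_(i, j) (v (fun y => complex.Re (h y i j)) +i*
                  v (fun y => complex.Im (h y i j))).

Definition smooth_mx k l (h : M -> 'M[R]_(k, l)) (x : M) : Prop :=
  forall i j, smooth_at (fun y => h y i j) x.

Definition smooth_cmx k l (h : M -> 'M[R[i]]_(k, l)) (x : M) : Prop :=
  forall i j, smooth_at (fun y => complex.Re (h y i j)) x /\
              smooth_at (fun y => complex.Im (h y i j)) x.
End Tangent.

Section Spin.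
Variables (R : realType) (n : nat).

Definition spin_dim : nat := (2 ^ n./2)%N.
Local Notation N := spin_dim.

(* A complex Clifford module structure on Delta_n = C^(2^[n/2]); this
   dimension forces irreducibility.  [herm_gram] is the Gram matrix of the
   hermitian product. *)
Record clifford_module := CliffordModule {
  gam : 'I_n -> 'M[R[i]]_N;
  herm_gram : 'M[R[i]]_N;
  clif := fun x : 'cV[R]_n => \sum_a (x a ord0)%:C *: gam a;
  hprod := fun u v : 'cV[R[i]]_N =>
    ((map_mx (@conjc R) v)^T *m herm_gram *m u) ord0 ord0;
  clif_sqr : forall x,
    clif x *m clif x = (- (\sum_a x a ord0 ^+ 2)%:C)%:M;
  hprod_sym : forall u v, hprod v u = conjc (hprod u v);
  hprod_pos : forall u, u != 0 -> 0 < complex.Re (hprod u u);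
  clif_skew : forall x u v, hprod (clif x *m u) v = - hprod u (clif x *m v) }.

Variable cl : clifford_module.

(* Spin(n), realised in End(Delta_n): the spin representation is faithful,
   so Spin(n), the group of even products of unit vectors of the Clifford
   algebra, is identified with its image and kappa is the inclusion. *)
Definition Spin (S : 'M[R[i]]_N) : Prop :=
  exists xs : seq 'cV[R]_n,
    [/\ ~~ odd (size xs),
        forall x, x \in xs -> \sum_a x a ord0 ^+ 2 = 1 &
        S = foldr (fun x T => clif cl x *m T) 1%:M xs].

(* A = lambda(S), i.e. S x S^-1 = A x for every x in R^n. *)
Definition is_lambda (S : 'M[R[i]]_N) (A : 'M[R]_n) : Prop :=
  forall x, S *m clif cl x = clif cl (A *m x) *m S.

Definition cspin := ('M[R[i]]_N * R)%type.

Definition CSpin (g : cspin) : Prop := Spin g.1 /\ 0 < g.2.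

(* A matrix A in co(n) is tau + A0 with tau = tr A / n and A0 skew. *)
Definition co (A : 'M[R]_n) : Prop := exists tau : R, A + A^T = tau%:M.

Definition co_trace (A : 'M[R]_n) : R := \tr A / n%:R.

(* The inverse image of A0 under the isomorphism spin(n) -> so(n) given by
   the derivative of lambda, (1/4) sum_(a,b) <A0 e_a, e_b> e_a e_b. *)
Definition spin_lift (A : 'M[R]_n) : 'M[R[i]]_N :=
  4^-1 *: \sum_a \sum_(b | b != a) (A b a)%:C *: (gam cl a *m gam cl b).
End Spin.

Section CSpinStructure.
Variables (R : realType) (n : nat) (M : smooth_manifold R n).
Variable cl : clifford_module R n.

(* s' = s g near x, for a smooth CSpin(n)-valued g. *)
Definition gauge_smooth (Q : Type) (act : Q -> cspin R n -> Q)
    (s s' : M -> Q) (x : M) : Prop :=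
  exists V (g : M -> cspin R n), open_nbhs x V /\
    forall y, V y ->
      [/\ CSpin cl (g y), smooth_cmx (fun z => (g z).1) y,
          smooth_at (fun z => (g z).2) y & s' y = act (s y) (g y)].

(* [s] is a smooth section over the open set U, the smooth structure being
   given by the local trivialisations attached to the sections [sec i]. *)
Definition is_local_section (Q : Type) (pi : Q -> M)
    (act : Q -> cspin R n -> Q) (I : Type) (dom : I -> set M)
    (sec : I -> M -> Q) (U : set M) (s : M -> Q) : Prop :=
  open U /\ forall x, U x ->
    pi (s x) = x /\ forall i, dom i x -> gauge_smooth act (sec i) s x.

(* A principal CSpin(n)-bundle (total space, projection, right action and
   local trivialisations) with its equivariant bundle map to P. *)
Record cspin_structure (o : M -> frame M -> Prop) (c : set (form2 M)) :=
  CSpinStructure {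
  total :> Type;
  proj : total -> M;
  act : total -> cspin R n -> total;
  act1 : forall q, act q (1%:M, 1) = q;
  actM : forall q g h, CSpin cl g -> CSpin cl h ->
    act (act q g) h = act q (g.1 *m h.1, g.2 * h.2);
  proj_act : forall q g, CSpin cl g -> proj (act q g) = proj q;
  act_simply_transitive : forall q q', proj q = proj q' ->
    exists! g, CSpin cl g /\ q' = act q g;
  triv_idx : Type;
  triv_dom : triv_idx -> set M;
  triv_sec : triv_idx -> M -> total;
  triv_cover : forall x, exists i, triv_dom i x;
  triv_secP : forall i,
    is_local_section proj act triv_dom triv_sec (triv_dom i) (triv_sec i);
  fr : total -> frame M;
  fr_conformal : forall q, conformal_frame o c (proj q) (fr q);
  fr_act : forall q g A, CSpin cl g -> is_lambda cl g.1 A ->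
    fr (act q g) = frame_act (fr q) (g.2 *: A);
  fr_smooth : forall U s,
    is_local_section proj act triv_dom triv_sec U s ->
    smooth_frame U (fun x => fr (s x)) }.

Definition local_section o c (Q : cspin_structure o c)
    (U : set M) (s : M -> Q) : Prop :=
  is_local_section (@proj o c Q) (@act o c Q) (@triv_dom o c Q)
    (@triv_sec o c Q) U s.

(* A torsion-free connection on P, given by its local connection forms:
   in a local section p of P, nabla_v p_b = sum_a (omega p v)_(a, b) p_a. *)
Record weyl_structure (o : M -> frame M -> Prop) (c : set (form2 M)) :=
  WeylStructure {
  conn :> (M -> frame M) -> M -> tvec M -> 'M[R]_n;
  conn_form : forall U p, open U -> smooth_frame U p ->
    (forall x, U x -> conformal_frame o c x (p x)) ->
    forall a b, smooth_form1 U (fun x v => conn p x v a b);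
  conn_co : forall U p, open U -> smooth_frame U p ->
    (forall x, U x -> conformal_frame o c x (p x)) ->
    forall x v, U x -> tangent x v -> co (conn p x v);
  conn_gauge : forall U p p' (h : M -> 'M[R]_n), open U ->
    smooth_frame U p -> (forall x, U x -> conformal_frame o c x (p x)) ->
    smooth_frame U p' -> (forall x, U x -> conformal_frame o c x (p' x)) ->
    (forall x, U x -> smooth_mx h x /\ p' x = frame_act (p x) (h x)) ->
    forall x v, U x -> tangent x v ->
      conn p' x v =
        invmx (h x) *m conn p x v *m h x + invmx (h x) *m d_mx v h;
  (* nabla_(p_a) p_b - nabla_(p_b) p_a = [p_a, p_b] *)
  conn_torsion_free : forall U p, open U -> smooth_frame U p ->
    (forall x, U x -> conformal_frame o c x (p x)) ->
    forall x a b, U x ->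
      bracket (fun y => p y a) (fun y => p y b) x =
        (fun f => vec (p x) (col b (conn p x (p x a))) f
                  - vec (p x) (col a (conn p x (p x b))) f) }.
End CSpinStructure.

(** A section of the bundle associated to a representation rho is a function
    on the total space with psi (q g) = rho (g)^-1 psi (q) that is smooth
    along local sections.  In the frame [fr q], the weightless orthonormal
    frame (e_i) is represented by the standard basis of R^n, so that e_i acts
    by [gam cl i] and a form is evaluated on e_i by evaluating it on
    [fr q i]. *)

Section Bundles.
Variables (R : realType) (n : nat) (M : smooth_manifold R n).
Variable cl : clifford_module R n.
Variables (o : M -> frame M -> Prop) (c : set (form2 M)).
Variable Q : cspin_structure cl o c.
Variable W : weyl_structure o c.
Local Notation N := (spin_dim n).

(* Gamma(L^w) *)
Definition is_density (w : R) (f : Q -> R) : Prop :=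
  (forall q g, CSpin cl g -> f (act q g) = g.2 `^ (- w) * f q) /\
  (forall U s, local_section U s ->
     forall x, U x -> smooth_at (fun y => f (s y)) x).

(* Gamma(S^w) *)
Definition is_spinor (w : R) (psi : Q -> 'cV[R[i]]_N) : Prop :=
  (forall q g, CSpin cl g ->
     psi (act q g) = (g.2 `^ (- w))%:C *: (invmx g.1 *m psi q)) /\
  (forall U s, local_section U s ->
     forall x, U x -> smooth_cmx (fun y => psi (s y)) x).

(* The covariant derivatives along v, in the local section s. *)
Definition nabla_density (w : R) (f : Q -> R) (s : M -> Q) (x : M)
    (v : tvec M) : R :=
  v (fun y => f (s y)) + w * co_trace (W (fun y => fr (s y)) x v) * f (s x).

Definition nabla_spinor (w : R) (psi : Q -> 'cV[R[i]]_N) (s : M -> Q) (x : M)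
    (v : tvec M) : 'cV[R[i]]_N :=
  let A := W (fun y => fr (s y)) x v in
  d_cmx v (fun y => psi (s y)) +
  ((w * co_trace A)%:C%:M + spin_lift cl A) *m psi (s x).

Definition parallel_density (w : R) (f : Q -> R) : Prop :=
  is_density w f /\
  forall U s x v, local_section U s -> U x -> tangent x v ->
    nabla_density w f s x v = 0.

(* phi = D psi *)
Definition is_dirac (w : R) (psi phi : Q -> 'cV[R[i]]_N) : Prop :=
  is_spinor (w - 1) phi /\
  forall U s x, local_section U s -> U x ->
    phi (s x) = \sum_a gam cl a *m nabla_spinor w psi s x (fr (s x) a).

(* nabla_X psi + (1/n) X . D psi = 0, where X = vec (fr (s x)) xi. *)
Definition is_twistor (w : R) (psi Dpsi : Q -> 'cV[R[i]]_N) : Prop :=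
  forall U s x (xi : 'cV[R]_n), local_section U s -> U x ->
    nabla_spinor w psi s x (vec (fr (s x)) xi) +
    (n%:R^-1)%:C *: (clif cl xi *m Dpsi (s x)) = 0.

(* l_g = |vol_g|^(-1/n), where vol_g is evaluated on the frame [fr q]. *)
Definition length_density (g : form2 M) (q : Q) : R :=
  let vol :=
    Num.sqrt (\det (\matrix_(a, b) g (proj q) (fr q a) (fr q b))) in
  `|vol| `^ (- n%:R^-1).

(* nabla l_g = theta (x) l_g *)
Definition is_lee_form (g : form2 M) (theta : form1 M) : Prop :=
  forall U s x v, local_section U s -> U x -> tangent x v ->
    nabla_density 1 (length_density g) s x v =
    theta x v * length_density g (s x).

(* theta depends on the choice of g in c, but d theta does not. *)
Definition is_faraday (F : form2 M) : Prop :=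
  exists g theta, [/\ c g, is_lee_form g theta & is_ext_deriv theta F].

(* (mu F) psi *)
Definition mu_form (F : form2 M) (psi : Q -> 'cV[R[i]]_N) (q : Q) :=
  \sum_i \sum_j (F (proj q) (fr q i) (fr q j))%:C *:
    (gam cl i *m (gam cl j *m psi q)).

(* (mu^2 B psi)(X), where X = vec (fr q) xi. *)
Definition mu_sq (B : form2 M) (psi : Q -> 'cV[R[i]]_N) (q : Q)
    (xi : 'cV[R]_n) :=
  \sum_j (B (proj q) (vec (fr q) xi) (fr q j))%:C *: (gam cl j *m psi q).

Definition normsq (u : 'cV[R[i]]_N) : R := complex.Re (hprod cl u u).

Definition twistor_C (psi Dpsi : Q -> 'cV[R[i]]_N) (q : Q) : R :=
  complex.Re (hprod cl (psi q) (Dpsi q)).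

Definition twistor_Q (psi Dpsi : Q -> 'cV[R[i]]_N) (q : Q) : R :=
  normsq (psi q) * normsq (Dpsi q) -
  \sum_i complex.Re (hprod cl (Dpsi q) (gam cl i *m psi q)) ^+ 2.
End Bundles.

(* Main.v *)
Require Import Defs.
From mathcomp Require Import all_boot all_order all_algebra.
From mathcomp Require Import all_classical all_reals all_analysis.
From mathcomp Require Import ring lra.
Import Order.TTheory GRing.Theory Num.Theory numFieldNormedType.Exports.
Local Open Scope classical_set_scope.
Local Open Scope ring_scope.
Local Open Scope complex_scope.
Set Implicit Arguments.
Unset Strict Implicit.
Unset Printing Implicit Defensive.

(** Write phi for the Dirac derivative D psi.  Everything rests on one fact:
    the covariant derivative of phi is Clifford multiplication of psi by a real
    vector, nabla_X phi = eta(X) . psi.  Granting it, the pair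
      nabla_X psi = - (1/n) X . phi,    nabla_X phi = eta(X) . psi
    makes both quantities parallel by elementary algebra ([parallel_C] and
    [parallel_Q]).  Clifford multiplication by a real vector v is
    skew-hermitian, so Re (v . chi, chi) = 0, and both terms of
    nabla_X Re (psi, phi) vanish.  The vectors e_i . psi are orthogonal for
    Re (., .) and all have the length of psi, so the coefficients of eta(X) and
    of X in the derivative of |psi|^2 |phi|^2 are exactly those in the derivative
    of the sum of squares.

    The fact itself is an integrability condition.  Differentiating the twistor
    equation a second time and antisymmetrising expresses the curvature R of
    nabla, acting on psi, by nabla phi ([twistor_integrability]):
      R(X, Y) psi = - (1/n) (Y . nabla_X phi - X . nabla_Y phi).
    Contracting this twice with Clifford multiplication solves for nabla_X phi
    ([nabla_phi_clifford]); the factor n / (n - 2) in the solution is where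
    n >= 3 enters.  The curvature on spinors of weight w is w F plus the
    spin lift of the tangent curvature, whose contraction with Clifford
    multiplication is a cubic Clifford expression.  For a Riemannian curvature
    tensor the first Bianchi identity leaves only the Ricci vector.  A Weyl
    curvature lacks the pair symmetry by terms in F, and those leave in
    addition a term X . F ([cubic_Rm0]).  Its coefficient is such that
    all the F-terms combine into
      (w - 1/2) (mu^2 F + (1 / (2 (n - 1))) nu mu F) psi,
    which is B . psi by the reduction hypothesis.  What remains is Clifford
    multiplication by the real Ricci and scalar curvature terms.

    The geometric input is checked in a local section s of the CSpin bundle, with
    the smooth vector fields E_a of the conformal frame under s and with the
    matrices A_a of the connection form evaluated on E_a.  The first Bianchi
    identity ([first_bianchi]) comes from commuting third derivatives of
    coordinate functions, using that the connection is torsion-free.  The trace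
    part of the curvature is the Faraday form ([faraday_curvature]), because the
    Lee form differs from the trace of the connection form by an exact form,
    the logarithmic derivative of the length density. *)

(** * Smooth functions *)

Section CkCalculus.
Variables (R : realType) (n : nat).
Implicit Types (U V : set 'rV[R]_n) (f g : 'rV[R]_n -> R).

Lemma eq_near_open U f g y : open U -> U y -> {in U, f =1 g} ->
  \near y, f y = g y.
Proof.
move=> oU Uy fg; near=> z; apply: fg; rewrite inE.
by near: z; apply: open_nbhs_nbhs.
Unshelve. all: by end_near. Qed.

Lemma continuous_ext_open U f g : open U -> {in U, f =1 g} ->
  (forall y, U y -> {for y, continuous f}) ->
  forall y, U y -> {for y, continuous g}.
Proof.
move=> oU fg cf y Uy; rewrite /prop_for /continuous_at -(fg y) ?inE//.
apply: (cvg_trans _ (cf y Uy)).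
apply: (@near_eq_cvg _ _ _ (nbhs_filter y)).
by apply: (eq_near_open oU Uy) => z zU; rewrite fg.
Qed.

Lemma Ck_ext k U f g : open U -> {in U, f =1 g} -> Ck k U f -> Ck k U g.
Proof.
elim: k f g => [|k IH] f g oU fg Cf.
  by have /= [cf _] := Cf; split=> //; exact: (continuous_ext_open oU fg).
have /= [cf df] := Cf; split; first exact: (continuous_ext_open oU fg).
move=> i; have [dfi {}Cf] := df i; split.
  move=> y Uy; apply: near_eq_derivable (dfi y Uy).
  exact: eq_near_open oU Uy fg.
apply: IH Cf => // y; rewrite inE => Uy.
exact: near_eq_derive (eq_near_open oU Uy fg).
Qed.

Lemma CkS k U f : Ck k.+1 U f -> Ck k U f.
Proof.
elim: k f => [|k IH] f /= [cf df]; split=> // i.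
by have [dfi /IH] := df i.
Qed.

Lemma Ck_sub k U V f : V `<=` U -> Ck k U f -> Ck k V f.
Proof.
move=> VU; elim: k f => [|k IH] f /= [cf df]; split=> //.
- by move=> y /VU /cf.
- by move=> y /VU /cf.
by move=> i; have [dfi Cf] := df i; split; [move=> y /VU /dfi | exact: IH].
Qed.

Lemma Ck_cst k U (a : R) : Ck k U (fun=> a).
Proof.
elim: k a => [|k IH] a /=; split=> //; try by move=> y _; exact: cst_continuous.
move=> i; split; first by move=> y _; exact: derivable_cst.
have -> : (fun y => 'D_(delta_mx ord0 i) (fun=> a) y) =
    (fun=> 0) :> ('rV[R]_n -> R).
  by apply/funext => y; exact: derive_cst.
exact: IH.
Qed.

Lemma CkD k U f g : open U -> Ck k U f -> Ck k U g ->
  Ck k U (fun y => f y + g y).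
Proof.
move=> oU; elim: k f g => [|k IH] f g /= [cf df] [cg dg]; split=> //.
- by move=> y Uy; apply: continuousD; [exact: cf|exact: cg].
- by move=> y Uy; apply: continuousD; [exact: cf|exact: cg].
move=> i; have [dfi Cf] := df i; have [dgi Cg] := dg i; split.
  by move=> y Uy; apply: derivableD; [exact: dfi|exact: dgi].
apply: Ck_ext (IH _ _ Cf Cg) => // y; rewrite inE => Uy.
by rewrite [RHS](deriveD (dfi y Uy) (dgi y Uy)).
Qed.

Lemma CkM k U f g : open U -> Ck k U f -> Ck k U g ->
  Ck k U (fun y => f y * g y).
Proof.
move=> oU; elim: k f g => [|k IH] f g Cf Cg.
  have /= [cf _] := Cf; have /= [cg _] := Cg; split=> // y Uy.
  by apply: continuousM; [exact: cf|exact: cg].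
have /= [cf df] := Cf; have /= [cg dg] := Cg; split=> //.
  by move=> y Uy; apply: continuousM; [exact: cf|exact: cg].
move=> i; have [dfi Cfi] := df i; have [dgi Cgi] := dg i; split.
  by move=> y Uy; apply: derivableM; [exact: dfi|exact: dgi].
apply: (@Ck_ext _ _ (fun y => f y * 'D_(delta_mx ord0 i) g y +
                         g y * 'D_(delta_mx ord0 i) f y)) => //.
  move=> y; rewrite inE => Uy.
  by rewrite [RHS](deriveM (dfi y Uy) (dgi y Uy)).
by apply: CkD => //; apply: IH => //; exact: CkS.
Qed.

(** The chain rule for a function of one variable composed with [f], reduced to
    one dimension by restricting [f] to the line through [y] in direction [v]. *)
Lemma is_derive_along_comp (h dh : R -> R) f (y v : 'rV[R]_n) :
  is_derive (f y) 1 h (dh (f y)) -> derivable f y v ->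
  is_derive y v (fun z => h (f z)) (dh (f y) * 'D_v f y).
Proof.
move=> [hd he] fd; have fd1 := (derivable1P f y v).1 fd.
set f1 := fun t : R => f (t *: v + y) in fd1.
have f10 : f1 0 = f y by rewrite /f1 scale0r add0r.
have D1 (F : 'rV[R]_n -> R) : 'D_v F y = derive1 (fun t : R => F (t *: v + y)) 0.
  rewrite derive1E /derive.
  set g1 := fun h => h^-1 *: _; set g2 := fun h => h^-1 *: _.
  suff -> : g1 = g2 by [].
  by rewrite funeqE /g1 /g2 => h' /=; rewrite addr0 scale0r add0r [_%:A]mulr1.
have hd1 := hd; rewrite -f10 in hd1.
split.
  apply/derivable1P/derivable1_diffP.
  by apply: (@differentiable_comp _ _ _ _ f1 h); apply/derivable1_diffP.
by rewrite D1 (derive1_comp fd1 hd1) D1 derive1E f10 he.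
Qed.

(** The exponent -1/2 is the one of the length density.  With p = f^(-1/2) the
    derivative is - (1/2) p^3 f', a polynomial in p and f', so the induction
    on [k] needs no other power of [f]. *)
Lemma Ck_powRN2 k U f : open U -> (forall y, U y -> 0 < f y) ->
  Ck k U f -> Ck k U (fun y => f y `^ (- 2^-1)).
Proof.
move=> oU f0; elim: k f f0 => [|k IH] f f0 Cf.
  have /= [cf _] := Cf; split=> // y Uy.
  apply: (@continuous_comp _ _ _ f (fun t => t `^ (- 2^-1))); first exact: cf.
  apply: differentiable_continuous; apply/derivable1_diffP.
  by case: (@is_derive1_powR R (- 2^-1) (f y) (f0 _ Uy)).
have /= [cf df] := Cf.
have der i y : U y -> is_derive y (delta_mx ord0 i)
    (fun z => f z `^ (- 2^-1))
    (- 2^-1 * f y `^ (- 2^-1 - 1) * 'D_(delta_mx ord0 i) f y).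
  move=> Uy; apply: (@is_derive_along_comp (fun t => t `^ (- 2^-1))
    (fun t => - 2^-1 * t `^ (- 2^-1 - 1)) f y); last exact: ((df i).1 y Uy).
  by apply: is_derive1_powR; exact: f0.
split=> //.
  by have := IH f f0 (CkS Cf); case: (k) => [|j] [].
move=> i; have [dfi Cfi] := df i; split.
  by move=> y Uy; case: (der i y Uy).
set p := fun y => f y `^ (- 2^-1).
have Cp : Ck k U p by apply: IH => //; exact: CkS.
apply: (@Ck_ext _ _ (fun y => (- 2^-1 * (p y * (p y * p y))) *
                          'D_(delta_mx ord0 i) f y)) => //.
  move=> y; rewrite inE => Uy; case: (der i y Uy) => _ ->.
  congr (_ * _ * _); rewrite /p.
  have fy0 : f y != 0 by rewrite gt_eqF // f0.
  rewrite -!powRD ?fy0 ?implybT //; congr (_ `^ _); lra.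
apply: CkM => //; apply: CkM => //; first exact: Ck_cst.
by apply: CkM => //; exact: CkM.
Qed.

Lemma smooth_near_ext f g p : (\near p, f p = g p) -> smooth_near f p ->
  smooth_near g p.
Proof.
move=> fg [U [oU Up] CU].
have : nbhs p [set y | f y = g y] by exact: fg.
rewrite nbhsE => -[V [oV Vp] VS].
exists (U `&` V); first by split; [exact: openI | split].
move=> k; apply: (@Ck_ext _ _ f); first exact: openI.
  by move=> y; rewrite inE => -[_ /VS].
by apply: Ck_sub (CU k) => y [].
Qed.

Lemma smooth_near_cst (a : R) (p : 'rV[R]_n) : smooth_near (fun=> a) p.
Proof.
by exists setT; [exact: (conj openT I)|move=> k; exact: Ck_cst].
Qed.

Lemma smooth_nearD f g p : smooth_near f p -> smooth_near g p ->
  smooth_near (fun y => f y + g y) p.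
Proof.
move=> [U [oU Up] CU] [V [oV Vp] CV].
exists (U `&` V); first by split; [exact: openI | split].
move=> k; apply: CkD; first exact: openI.
  by apply: Ck_sub (CU k) => y [].
by apply: Ck_sub (CV k) => y [].
Qed.

Lemma smooth_nearM f g p : smooth_near f p -> smooth_near g p ->
  smooth_near (fun y => f y * g y) p.
Proof.
move=> [U [oU Up] CU] [V [oV Vp] CV].
exists (U `&` V); first by split; [exact: openI | split].
move=> k; apply: CkM; first exact: openI.
  by apply: Ck_sub (CU k) => y [].
by apply: Ck_sub (CV k) => y [].
Qed.

Lemma smooth_near_powRN2 f p : 0 < f p -> smooth_near f p ->
  smooth_near (fun y => f y `^ (- 2^-1)) p.
Proof.
move=> f0 [U [oU Up] CU]; have cf y : U y -> {for y, continuous f}.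
  by case: (CU 0%N) => + _; apply.
exists (U `&` f @^-1` [set t | 0 < t]).
  split; last by split.
  rewrite openE => y [Uy fy]; apply: filterI; first exact: open_nbhs_nbhs.
  by apply: (cf y Uy); apply: open_nbhs_nbhs; split=> //; exact: open_gt.
have oI : open (U `&` f @^-1` [set t | 0 < t]).
  rewrite openE => y [Uy fy]; apply: filterI; first exact: open_nbhs_nbhs.
  by apply: (cf y Uy); apply: open_nbhs_nbhs; split=> //; exact: open_gt.
move=> k; apply: Ck_powRN2 => //; first by move=> y [].
by apply: Ck_sub (CU k) => y [].
Qed.
End CkCalculus.

Section SmoothFunctions.
Variables (R : realType) (n : nat) (M : smooth_manifold R n).
Implicit Types (f g : M -> R) (x : M).

(** Carries a property holding near a point of the manifold to the chart, where
    smoothness is defined. *)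
Lemma near_chart x (P : set M) i : chart_dom i x -> (\near x, P x) ->
  \forall y \near chart i x, P (chart_inv i y).
Proof.
move=> ix Px; apply: (chart_inv_continuous ix).
by rewrite chartK.
Qed.

Lemma smooth_at_ext f g x : (\near x, f x = g x) -> smooth_at f x ->
  smooth_at g x.
Proof.
move=> fg sf i ix; apply: smooth_near_ext (sf i ix).
exact: (near_chart ix fg).
Qed.

Lemma smooth_at_cst (a : R) x : smooth_at (fun=> a) x.
Proof. by move=> i ix; exact: smooth_near_cst. Qed.

Lemma smooth_atD f g x : smooth_at f x -> smooth_at g x ->
  smooth_at (fun y => f y + g y) x.
Proof.
by move=> sf sg i ix; apply: (smooth_nearD (sf i ix) (sg i ix)).
Qed.

Lemma smooth_atM f g x : smooth_at f x -> smooth_at g x ->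
  smooth_at (fun y => f y * g y) x.
Proof.
by move=> sf sg i ix; apply: (smooth_nearM (sf i ix) (sg i ix)).
Qed.

Lemma smooth_atZ (a : R) f x : smooth_at f x -> smooth_at (fun y => a * f y) x.
Proof. by apply: smooth_atM; exact: smooth_at_cst. Qed.

Lemma smooth_atN f x : smooth_at f x -> smooth_at (fun y => - f y) x.
Proof.
move=> /(smooth_atZ (-1)); congr smooth_at.
by apply/funext=> y; rewrite mulN1r.
Qed.

Lemma smooth_atB f g x : smooth_at f x -> smooth_at g x ->
  smooth_at (fun y => f y - g y) x.
Proof. by move=> sf /smooth_atN; apply: smooth_atD. Qed.

Lemma smooth_at_sum (I : Type) (r : seq I) (P : pred I) (f : I -> M -> R) x :
  (forall i, P i -> smooth_at (f i) x) ->
  smooth_at (fun y => \sum_(i <- r | P i) f i y) x.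
Proof.
move=> sf; elim: r => [|i r IH].
  rewrite (_ : (fun y => _) = fun=> 0); first exact: smooth_at_cst.
  by apply/funext=> y; rewrite big_nil.
rewrite (_ : (fun y => _) = fun y =>
    (if P i then f i y else 0) + \sum_(j <- r | P j) f j y).
  apply: smooth_atD => //; case Pi: (P i); first exact: sf.
  exact: smooth_at_cst.
by apply/funext=> y; rewrite big_cons; case: ifP => // _; rewrite add0r.
Qed.

Lemma smooth_at_powRN2 f x : 0 < f x -> smooth_at f x ->
  smooth_at (fun y => f y `^ (- 2^-1)) x.
Proof.
move=> f0 sf i ix.
by apply: (smooth_near_powRN2 _ (sf i ix)); rewrite chartK.
Qed.
End SmoothFunctions.

Arguments smooth_at_cst {R n M} a x.

(** * Tangent vectors as derivations *)

Section Derivations.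
Variables (R : realType) (n : nat) (M : smooth_manifold R n).
Variables (x : M) (v : tvec M).
Hypothesis tv : tangent x v.
Implicit Types (f g : M -> R).

Lemma tangentD f g : smooth_at f x -> smooth_at g x ->
  v (fun y => f y + g y) = v f + v g.
Proof.
move=> sf sg; have := tangent_linear tv 1 sf sg; rewrite mul1r => <-.
by congr v; apply/funext=> y; rewrite mul1r.
Qed.

Lemma tangent0 : v (fun=> 0) = 0.
Proof.
have := tangentD (smooth_at_cst 0 x) (smooth_at_cst 0 x).
rewrite (_ : (fun=> 0 + 0) = (fun=> 0)); last by apply/funext=> y; rewrite addr0.
by move/eqP; rewrite -{1}[v _]addr0 (inj_eq (addrI _)) eq_sym => /eqP.
Qed.

Lemma tangentZ (a : R) f : smooth_at f x -> v (fun y => a * f y) = a * v f.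
Proof.
move=> sf; have := tangent_linear tv a sf (smooth_at_cst 0 x).
rewrite tangent0 addr0 => <-.
by congr v; apply/funext=> y; rewrite addr0.
Qed.

Lemma tangent_cst (a : R) : v (fun=> a) = 0.
Proof.
have s1 := smooth_at_cst 1 x.
have v1 : v (fun=> 1) = 0.
  have := tangent_leibniz tv s1 s1.
  rewrite (_ : (fun=> 1 * 1) = (fun=> 1)); last by apply/funext=> y; rewrite mulr1.
  rewrite mulr1 mul1r => /eqP.
  by rewrite -{1}[v _]addr0 (inj_eq (addrI _)) eq_sym => /eqP.
have := tangentZ a s1; rewrite v1 mulr0 => <-.
by congr v; apply/funext=> y; rewrite mulr1.
Qed.

Lemma tangentM f g : smooth_at f x -> smooth_at g x ->
  v (fun y => f y * g y) = v f * g x + f x * v g.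
Proof. exact: tangent_leibniz. Qed.

Lemma tangentN f : smooth_at f x -> v (fun y => - f y) = - v f.
Proof.
move=> sf; rewrite -[RHS]mulN1r -tangentZ//.
by congr v; apply/funext=> y; rewrite mulN1r.
Qed.

Lemma tangentB f g : smooth_at f x -> smooth_at g x ->
  v (fun y => f y - g y) = v f - v g.
Proof.
move=> sf sg; rewrite -tangentN//; apply: tangentD => //.
exact: smooth_atN.
Qed.

Lemma tangent_sum (I : Type) (r : seq I) (P : pred I) (f : I -> M -> R) :
  (forall i, P i -> smooth_at (f i) x) ->
  v (fun y => \sum_(i <- r | P i) f i y) = \sum_(i <- r | P i) v (f i).
Proof.
move=> sf; elim: r => [|i r IH].
  by rewrite big_nil -[RHS]tangent0; congr v; apply/funext=> y; rewrite big_nil.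
rewrite big_cons; case Pi: (P i); last first.
  by rewrite -IH; congr v; apply/funext=> y; rewrite big_cons Pi.
rewrite -IH -tangentD; [|exact: sf|exact: smooth_at_sum].
by congr v; apply/funext=> y; rewrite big_cons Pi.
Qed.

Lemma tangent_ext f g : (\near x, f x = g x) -> smooth_at f x -> v f = v g.
Proof.
move=> fg sf; apply: (tangent_local tv sf) => //.
exact: smooth_at_ext fg sf.
Qed.

(** Unfolds to what [smooth_cmx] requires of each entry, so that lemmas on complex
    functions apply entrywise. *)
Definition csmooth_at (h : M -> R[i]) (y : M) :=
  smooth_at (fun z => complex.Re (h z)) y /\
  smooth_at (fun z => complex.Im (h z)) y.

Definition dC (w : tvec M) (h : M -> R[i]) : R[i] :=
  w (fun y => complex.Re (h y)) +i* w (fun y => complex.Im (h y)).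

Lemma csmooth_eq h k y : h =1 k -> csmooth_at h y -> csmooth_at k y.
Proof. by move=> /funext ->. Qed.

Lemma csmooth_cst (a : R[i]) (y : M) : csmooth_at (fun=> a) y.
Proof. by split; exact: smooth_at_cst. Qed.

Lemma csmooth_real f y : smooth_at f y -> csmooth_at (fun z => (f z)%:C) y.
Proof. by split=> //=; exact: smooth_at_cst. Qed.

Lemma csmoothD h k y : csmooth_at h y -> csmooth_at k y ->
  csmooth_at (fun z => h z + k z) y.
Proof.
move=> [hr hi] [kr ki]; split.
  by have := smooth_atD hr kr; congr smooth_at; apply/funext=> z; rewrite raddfD.
by have := smooth_atD hi ki; congr smooth_at; apply/funext=> z; rewrite raddfD.
Qed.

Let ReM (a b : R[i]) : complex.Re (a * b) =
  complex.Re a * complex.Re b - complex.Im a * complex.Im b.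
Proof. by case: a b => [? ?] [? ?]. Qed.

Let ImM (a b : R[i]) : complex.Im (a * b) =
  complex.Re a * complex.Im b + complex.Im a * complex.Re b.
Proof. by case: a b => [? ?] [? ?]. Qed.

Lemma csmoothM h k y : csmooth_at h y -> csmooth_at k y ->
  csmooth_at (fun z => h z * k z) y.
Proof.
move=> [hr hi] [kr ki]; split.
  have := smooth_atB (smooth_atM hr kr) (smooth_atM hi ki).
  by congr smooth_at; apply/funext=> z; rewrite ReM.
have := smooth_atD (smooth_atM hr ki) (smooth_atM hi kr).
by congr smooth_at; apply/funext=> z; rewrite ImM.
Qed.

Lemma csmooth_conj h y : csmooth_at h y -> csmooth_at (fun z => conjc (h z)) y.
Proof.
move=> [hr hi]; split.
  by move: hr; congr smooth_at; apply/funext=> z; case: (h z).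
by have := smooth_atN hi; congr smooth_at; apply/funext=> z; case: (h z).
Qed.

Lemma csmooth_sum (I : Type) (r : seq I) (P : pred I) (h : I -> M -> R[i]) y :
  (forall i, P i -> csmooth_at (h i) y) ->
  csmooth_at (fun z => \sum_(i <- r | P i) h i z) y.
Proof.
move=> sh; split.
  have := @smooth_at_sum _ _ _ _ r P (fun i z => complex.Re (h i z)) y
    (fun i Pi => (sh i Pi).1).
  by congr smooth_at; apply/funext=> z; rewrite raddf_sum.
have := @smooth_at_sum _ _ _ _ r P (fun i z => complex.Im (h i z)) y
  (fun i Pi => (sh i Pi).2).
by congr smooth_at; apply/funext=> z; rewrite raddf_sum.
Qed.

Lemma dC_ext h k : (\near x, h x = k x) -> csmooth_at h x -> dC v h = dC v k.
Proof.
move=> hk [sr si]; congr (_ +i* _); apply: tangent_ext => //;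
  by apply: filterS hk => y ->.
Qed.

Lemma dC_cst (a : R[i]) : dC v (fun=> a) = 0.
Proof. by rewrite /dC !tangent_cst. Qed.

Lemma dC_real f : dC v (fun y => (f y)%:C) = (v f)%:C.
Proof. by rewrite /dC /= tangent_cst. Qed.

Lemma dCD h k : csmooth_at h x -> csmooth_at k x ->
  dC v (fun y => h y + k y) = dC v h + dC v k.
Proof.
move=> [hr hi] [kr ki]; rewrite /dC.
under eq_fun do rewrite raddfD.
under [in X in _ +i* X]eq_fun do rewrite raddfD.
by rewrite !tangentD.
Qed.

Lemma dCM h k : csmooth_at h x -> csmooth_at k x ->
  dC v (fun y => h y * k y) = dC v h * k x + h x * dC v k.
Proof.
move=> [hr hi] [kr ki]; rewrite /dC.
under eq_fun do rewrite ReM.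
under [in X in _ +i* X]eq_fun do rewrite ImM.
rewrite tangentB ?tangentD ?tangentM //; try exact: smooth_atM.
case: (h x) (k x) => [a b] [c d] /=.
by apply/eqP; rewrite eq_complex /=; apply/andP; split; apply/eqP; ring.
Qed.

Lemma dC_conj h : csmooth_at h x ->
  dC v (fun y => conjc (h y)) = conjc (dC v h).
Proof.
move=> [hr hi]; rewrite /dC /= -tangentN //.
by congr (_ +i* _); congr v; apply/funext=> y; case: (h y).
Qed.

Lemma dC_sum (I : Type) (r : seq I) (P : pred I) (h : I -> M -> R[i]) :
  (forall i, P i -> csmooth_at (h i) x) ->
  dC v (fun y => \sum_(i <- r | P i) h i y) = \sum_(i <- r | P i) dC v (h i).
Proof.
move=> sh; elim: r => [|i r IH].
  rewrite big_nil -[RHS](dC_cst 0); congr dC; apply/funext=> y.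
  by rewrite big_nil.
rewrite big_cons; case Pi: (P i); last first.
  by rewrite -IH; congr dC; apply/funext=> y; rewrite big_cons Pi.
rewrite -IH -dCD; [|exact: sh|exact: csmooth_sum].
by congr dC; apply/funext=> y; rewrite big_cons Pi.
Qed.

Lemma d_cmxE k l (h : M -> 'M[R[i]]_(k, l)) i j :
  d_cmx v h i j = dC v (fun y => h y i j).
Proof. by rewrite mxE. Qed.

Lemma d_cmx_ext k l (h h' : M -> 'M[R[i]]_(k, l)) :
  (\near x, h x = h' x) -> smooth_cmx h x -> d_cmx v h = d_cmx v h'.
Proof.
move=> hh sh; apply/matrixP=> i j; rewrite !d_cmxE.
by apply: dC_ext (sh i j); apply: filterS hh => y ->.
Qed.

Lemma smooth_cmxM k l m (h : M -> 'M[R[i]]_(k, l)) (g : M -> 'M[R[i]]_(l, m)) y :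
  smooth_cmx h y -> smooth_cmx g y -> smooth_cmx (fun z => h z *m g z) y.
Proof.
move=> sh sg i j.
have := @csmooth_sum _ (index_enum 'I_l) predT
  (fun e z => h z i e * g z e j) y (fun e _ => csmoothM (sh i e) (sg e j)).
by apply: csmooth_eq => z; rewrite mxE.
Qed.

Lemma smooth_cmxD k l (h g : M -> 'M[R[i]]_(k, l)) y :
  smooth_cmx h y -> smooth_cmx g y -> smooth_cmx (fun z => h z + g z) y.
Proof.
move=> sh sg i j; have := csmoothD (sh i j) (sg i j).
by apply: csmooth_eq => z; rewrite mxE.
Qed.

Lemma smooth_cmxZ k l (f : M -> R) (h : M -> 'M[R[i]]_(k, l)) y :
  smooth_at f y -> smooth_cmx h y -> smooth_cmx (fun z => (f z)%:C *: h z) y.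
Proof.
move=> sf sh i j; have := csmoothM (csmooth_real sf) (sh i j).
by apply: csmooth_eq => z; rewrite mxE.
Qed.

Lemma smooth_cmx_cst k l (h : 'M[R[i]]_(k, l)) (y : M) :
  smooth_cmx (fun=> h) y.
Proof. by move=> i j; exact: csmooth_cst. Qed.

Lemma smooth_cmx_sum k l (I : Type) (r : seq I) (P : pred I)
  (h : I -> M -> 'M[R[i]]_(k, l)) y :
  (forall a, P a -> smooth_cmx (h a) y) ->
  smooth_cmx (fun z => \sum_(a <- r | P a) h a z) y.
Proof.
move=> sh i j; have := @csmooth_sum _ r P (fun a z => h a z i j) y
  (fun a Pa => sh a Pa i j).
by apply: csmooth_eq => z; rewrite summxE.
Qed.

Lemma d_cmxM k l m (h : M -> 'M[R[i]]_(k, l)) (g : M -> 'M[R[i]]_(l, m)) :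
  smooth_cmx h x -> smooth_cmx g x ->
  d_cmx v (fun z => h z *m g z) = d_cmx v h *m g x + h x *m d_cmx v g.
Proof.
move=> sh sg; apply/matrixP=> i j; rewrite d_cmxE.
under eq_fun do rewrite mxE.
rewrite dC_sum; last by move=> e _; exact: csmoothM (sh i e) (sg e j).
rewrite !mxE -big_split /=; apply: eq_bigr => e _.
by rewrite (dCM (sh i e) (sg e j)) !d_cmxE.
Qed.

Lemma d_cmxD k l (h g : M -> 'M[R[i]]_(k, l)) :
  smooth_cmx h x -> smooth_cmx g x ->
  d_cmx v (fun z => h z + g z) = d_cmx v h + d_cmx v g.
Proof.
move=> sh sg; apply/matrixP=> i j; rewrite [RHS]mxE !d_cmxE.
by under eq_fun do rewrite mxE; exact: dCD (sh i j) (sg i j).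
Qed.

Lemma d_cmxZ k l (f : M -> R) (h : M -> 'M[R[i]]_(k, l)) :
  smooth_at f x -> smooth_cmx h x ->
  d_cmx v (fun z => (f z)%:C *: h z) = (v f)%:C *: h x + (f x)%:C *: d_cmx v h.
Proof.
move=> sf sh; apply/matrixP=> i j; rewrite d_cmxE.
under eq_fun do rewrite mxE.
by rewrite (dCM (csmooth_real sf) (sh i j)) dC_real -d_cmxE !mxE.
Qed.

Lemma d_cmx_cst k l (h : 'M[R[i]]_(k, l)) : d_cmx v (fun=> h) = 0.
Proof. by apply/matrixP=> i j; rewrite d_cmxE dC_cst mxE. Qed.

Lemma d_cmx_sum k l (I : Type) (r : seq I) (P : pred I)
  (h : I -> M -> 'M[R[i]]_(k, l)) :
  (forall a, P a -> smooth_cmx (h a) x) ->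
  d_cmx v (fun z => \sum_(a <- r | P a) h a z) =
  \sum_(a <- r | P a) d_cmx v (h a).
Proof.
move=> sh; apply/matrixP=> i j; rewrite d_cmxE summxE.
under eq_fun do rewrite summxE.
rewrite dC_sum; last by move=> a Pa; exact: sh.
by apply: eq_bigr => a _; rewrite d_cmxE.
Qed.
End Derivations.

Section Frames.
Variables (R : realType) (n : nat) (M : smooth_manifold R n).
Variables (x : M).

Lemma tangent_zero : tangent x (fun=> 0).
Proof. by split=> *; rewrite ?mulr0 ?mul0r ?addr0. Qed.

Lemma tangent_comb (a : R) (u v : tvec M) : tangent x u -> tangent x v ->
  tangent x (fun f => a * u f + v f).
Proof.
move=> tu tv; split=> [b f g sf sg|f g sf sg|f g sf sg fg|f nf].
- by rewrite (tangent_linear tu) // (tangent_linear tv) //; ring.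
- by rewrite (tangent_leibniz tu) // (tangent_leibniz tv) //; ring.
- by rewrite (tangent_local tu sf sg fg) (tangent_local tv sf sg fg).
- by rewrite (tangent_junk tu nf) (tangent_junk tv nf) mulr0 addr0.
Qed.

Variable e : frame M.
Hypothesis te : forall a, tangent x (e a).

Lemma tangent_vec_seq (r : seq 'I_n) (xi : 'cV[R]_n) :
  tangent x (fun f => \sum_(a <- r) xi a ord0 * e a f).
Proof.
elim: r => [|a r IH].
  by under eq_fun do rewrite big_nil; exact: tangent_zero.
by under eq_fun do rewrite big_cons; exact: tangent_comb.
Qed.

Lemma tangent_vec (xi : 'cV[R]_n) : tangent x (vec e xi).
Proof. exact: tangent_vec_seq. Qed.

(** A form is assumed linear on tangent vectors only, whence the induction over
    partial sums, each of which is again tangent. *)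
Lemma linear_form_vec (t : tvec M -> R) (xi : 'cV[R]_n) :
  (forall (a : R) u v, tangent x u -> tangent x v ->
     t (fun f => a * u f + v f) = a * t u + t v) ->
  t (vec e xi) = \sum_a xi a ord0 * t (e a).
Proof.
move=> lt; have t0 : t (fun=> 0) = 0.
  have := lt 1 _ _ tangent_zero tangent_zero.
  rewrite (_ : (fun f => 1 * 0 + 0) = (fun=> 0)); last first.
    by apply/funext=> y; rewrite mulr0 addr0.
  by rewrite mul1r => /eqP; rewrite -{1}[t _]addr0 (inj_eq (addrI _)) eq_sym => /eqP.
rewrite /vec; elim: (index_enum 'I_n) => [|a r IH].
  rewrite big_nil -[RHS]t0; congr t; apply/funext=> f; exact: big_nil.
rewrite big_cons -IH -lt //; last exact: tangent_vec_seq.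
congr t; apply/funext=> f; exact: big_cons.
Qed.

Lemma vec_delta a : vec e (delta_mx a ord0) = e a.
Proof.
apply/funext=> f; rewrite /vec (bigD1 a) //= big1 => [|b ba].
  by rewrite mxE !eqxx mul1r addr0.
by rewrite mxE (negPf ba) mul0r.
Qed.
End Frames.

Section Coordinates.
Variables (R : realType) (n : nat) (M : smooth_manifold R n).
Variables (x : M) (i : chart_idx M).
Hypothesis ix : chart_dom i x.

Definition coord (k : 'I_n) : M -> R := fun y => chart i y ord0 k.

(** Coordinates are smooth at every point of their chart domain.  A function
    smooth at [x] alone is a germ whose smoothness at nearby points would need
    the chain rule for changes of charts; testing vector fields on coordinates
    avoids it. *)
Lemma smooth_coord k y : chart_dom i y -> smooth_at (coord k) y.
Proof. by move=> iy j jy; exact: chart_compat. Qed.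

(** The partial derivative in the chart, with the value 0 that a tangent vector
    takes by convention on functions that are not smooth. *)
Definition pd (a : 'I_n) : tvec M := fun f =>
  if `[< smooth_at f x >] then
    'D_(delta_mx ord0 a) (fun y => f (chart_inv i y)) (chart i x)
  else 0.

Lemma smooth_derivable a f : smooth_at f x ->
  derivable (fun y => f (chart_inv i y)) (chart i x) (delta_mx ord0 a : 'rV_n).
Proof.
move=> /(_ i ix) [U [oU Ux] /(_ 1%N) [_ /(_ a) [df _]]].
exact: df.
Qed.

Lemma pdE f a : smooth_at f x ->
  pd a f = 'D_(delta_mx ord0 a) (fun y => f (chart_inv i y)) (chart i x).
Proof. by move=> sf; rewrite /pd asboolT. Qed.

Lemma tangent_pd a : tangent x (pd a).
Proof.
split=> [c f g sf sg|f g sf sg|f g sf sg fg|f nf].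
- have sc := smooth_atZ c sf.
  rewrite !pdE //; last exact: smooth_atD.
  have df := smooth_derivable (a:=a) sf; have dg := smooth_derivable (a:=a) sg.
  have dc := smooth_derivable (a:=a) sc.
  rewrite [LHS](deriveD dc dg); congr (_ + _).
  by rewrite -[RHS](deriveZ c df).
- rewrite !pdE //; last exact: smooth_atM.
  have df := smooth_derivable (a:=a) sf; have dg := smooth_derivable (a:=a) sg.
  by rewrite [LHS](deriveM df dg) !chartK // addrC mulrC.
- rewrite !pdE //; apply: near_eq_derive.
  exact: (near_chart ix fg).
- by rewrite /pd asboolF.
Qed.

Lemma pd_coord a k : pd a (coord k) = (a == k)%:R.
Proof.
rewrite pdE; last exact: smooth_coord.
rewrite (@near_eq_derive _ _ _ _ (fun y : 'rV[R]_n => y ord0 k)); last first.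
  have oI : open (chart i @` chart_dom i) by exact: chart_img_open.
  have : nbhs (chart i x) (chart i @` chart_dom i).
    by apply: open_nbhs_nbhs; split=> //; exists x.
  by apply: filterS => y [z iz <-]; rewrite /coord chartK.
have der : is_derive (chart i x) (delta_mx ord0 a) (fun y : 'rV[R]_n => y ord0 k)
    ((delta_mx ord0 a : 'rV[R]_n) ord0 k).
  apply: DeriveDef; first exact/diff_derivable/differentiable_coord.
  have := derive_mx (@derivable_id R 'rV[R]_n (chart i x) (delta_mx ord0 a)).
  by rewrite derive_id => /matrixP /(_ ord0 k); rewrite [in RHS]mxE => ->.
by rewrite derive_val mxE eqxx eq_sym.
Qed.

(** Partial derivatives are tangent vectors, hence combinations of the frame,
    and they are dual to the coordinates.  So the square matrix of the
    derivatives of the coordinates along the frame has a one-sided inverse, and a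
    combination of frame vectors is determined by its values on coordinates. *)
Lemma coord_separate (e : frame M) (C : 'cV[R]_n) : is_frame x e ->
  (forall k, vec e C (coord k) = 0) -> C = 0.
Proof.
move=> [te fe] C0.
have /choice [P PE] a : exists xi, pd a = vec e xi.
  by have [xi [? _]] := fe _ (tangent_pd a); exists xi.
pose X : 'M[R]_n := \matrix_(c, k) e c (coord k).
pose Pm : 'M[R]_n := \matrix_(a, c) P a c ord0.
have PX : Pm *m X = 1%:M.
  apply/matrixP=> a k; rewrite !mxE -pd_coord PE /vec.
  by apply: eq_bigr => c _; rewrite !mxE.
have CX : C^T *m X = 0.
  apply/matrixP=> a k; rewrite !mxE -[RHS](C0 k) /vec.
  by apply: eq_bigr => c _; rewrite !mxE (ord1 a).
by apply: trmx_inj; rewrite -[C^T]mulmx1 -(mulmx1C PX) mulmxA CX mul0mx trmx0.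
Qed.
End Coordinates.

(** * Clifford contractions of a Weyl curvature tensor *)

Section MatrixEntries.
Variables (K : nzRingType) (m n : nat).
Implicit Types A B : 'M[K]_(m, n).

Lemma mxD A B i j : (A + B) i j = A i j + B i j.
Proof. exact: mxE. Qed.

Lemma mxN A i j : (- A) i j = - A i j.
Proof. exact: mxE. Qed.

Lemma mxZ (a : K) A i j : (a *: A) i j = a * A i j.
Proof. exact: mxE. Qed.
End MatrixEntries.

(** Linear identities between matrices are checked entrywise.  The rewriting is
    restricted to sums, opposites and multiples: every other matrix is kept as an
    atom, instead of being compared with the general form of a matrix given by
    its entries. *)
Ltac mx_entries :=
  apply/matrixP=> ? ?; do ?[rewrite mxD | rewrite mxN | rewrite mxZ].
Ltac mx_ring := mx_entries; ring.
Ltac mx_field := mx_entries; field; exact: isT.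

(** The lemmas of this section are the linear systems solved along the way,
    stated for arbitrary matrices so that the products and sums they are applied
    to remain opaque. *)
Section LinearCombinations.
Variables (R : realType) (m n : nat).
Implicit Types (X Y Z U : 'M[R[i]]_(m, n)) (t : R).
Local Notation "x *:: X" := (x%:C *: X) (at level 40).

Lemma skew_part X Y t :
  X = 2^-1 *:: (X - (- X - (2 * t) *:: Y)) - t *:: Y.
Proof. by mx_field. Qed.

Lemma scale4 X : 4 *:: X = 2 *:: X + 2 *:: X.
Proof. by mx_ring. Qed.

Lemma third_part X Y Z U :
  X + (X + 2 *:: Y) + (X + 4 *:: Y) = - (U + (U + 2 *:: Z) + (U + 4 *:: Z)) ->
  X = - U - 2 *:: Z - 2 *:: Y.
Proof.
have -> : X + (X + 2 *:: Y) + (X + 4 *:: Y) = 3 *:: (X + 2 *:: Y).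
  by mx_ring.
have -> : - (U + (U + 2 *:: Z) + (U + 4 *:: Z)) = 3 *:: (- U - 2 *:: Z).
  by mx_ring.
move=> /scalerI e; rewrite -e ?addrK // fmorph_eq0 pnatr_eq0 //.
Qed.

Lemma quarter_part X Y Z :
  4^-1 *:: (- X - 2 *:: Y - 2 *:: Z) =
  - (4^-1 *:: X) - 2^-1 *:: Y - 2^-1 *:: Z.
Proof. by mx_field. Qed.

Lemma sqr_part X Y : X = - X - 2 *:: Y -> X = - Y.
Proof.
move=> e; have -> : X = 2^-1 *:: (X + X) by mx_field.
by rewrite {2}e; mx_field.
Qed.

Lemma ricci_part (k t : R) X Y :
  (k / 4) *:: X - 2^-1 *:: X -
    2^-1 *:: (2^-1 *:: ((2 - k) *:: X) - t *:: Y) =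
  ((k - 2) / 2) *:: X + (t / 2) *:: Y.
Proof. by mx_field. Qed.

(** The last elimination: [X] is the wanted derivative of phi, [D] its full
    Clifford contraction multiplied by the same frame vector, [V] the contracted
    curvature, [f] and [G] the two F-terms, [r] and [p] the Ricci and scalar
    terms, the last four applied to psi.  The coefficient of [G] in
    V + D / k, which is (1 - 2 / k) X, is
      w / (2 (k - 1)) - 1/4 + (k - 2) / (4 (k - 1)),
    which equals (w - 1/2) / (2 (k - 1)): this is what makes the combination of
    the reduction hypothesis appear. *)
Lemma schouten_part (k w t : R) (X D V G f r p b : 'M[R[i]]_(m, n)) :
  k != 0 -> k - 1 != 0 -> k - 2 != 0 ->
  V = (1 - 2 / k) *:: X - k^-1 *:: D ->
  (2 - 2 / k) *:: D = w *:: G + (((k - 2) / 2) *:: G + (t / 2) *:: p) ->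
  V = w *:: f + (- (4^-1 *:: G) - 2^-1 *:: f - 2^-1 *:: r) ->
  (w - 2^-1) *:: (f + (2 * (k - 1))^-1 *:: G) = b ->
  X = (k / (k - 2)) *:: (b + (- 2^-1 *:: r + t / (4 * (k - 1)) *:: p)).
Proof.
move=> k0 k1 k2 h1 h2 h3 <-.
have kC0 : k%:C != 0 by rewrite fmorph_eq0.
have kC1 : k%:C - 1 != 0 by rewrite -(rmorph1 (real_complex R)) -rmorphB fmorph_eq0.
have kC2 : k%:C - 2 != 0.
  by rewrite -(rmorph_nat (real_complex R) 2) -rmorphB fmorph_eq0.
have -> : X = (k / (k - 2)) *:: (V + k^-1 *:: D).
  by rewrite h1; mx_entries; field; rewrite ?kC0 ?kC1 ?kC2.
have -> : D = (k / (2 * (k - 1))) *:: ((2 - 2 / k) *:: D).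
  by mx_entries; field; rewrite ?kC0 ?kC1 ?kC2.
by rewrite h2 h3; mx_entries; field; rewrite ?kC0 ?kC1 ?kC2.
Qed.
End LinearCombinations.

Section CliffordAlgebra.
Variables (R : realType) (n : nat) (cl : clifford_module R n).
Local Notation N := (spin_dim n).
Local Notation "x *:: X" := (x%:C *: X) (at level 40).
Local Notation g := (gam cl).
Implicit Types (x y : 'cV[R]_n).

Lemma clifE x : clif cl x = \sum_a x a ord0 *:: g a.
Proof. by []. Qed.

Lemma clifD x y : clif cl (x + y) = clif cl x + clif cl y.
Proof.
rewrite !clifE -big_split; apply: eq_bigr => a _ /=.
by rewrite mxE rmorphD scalerDl.
Qed.

Lemma clifZ (t : R) x : clif cl (t *: x) = t *:: clif cl x.
Proof.
rewrite !clifE scaler_sumr; apply: eq_bigr => a _ /=.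
by rewrite mxE rmorphM scalerA.
Qed.

Lemma clif_delta a : clif cl (delta_mx a ord0) = g a.
Proof.
rewrite clifE (bigD1 a) //= big1 => [|b ba].
  by rewrite mxE !eqxx scale1r addr0.
by rewrite mxE (negPf ba) scale0r.
Qed.

Definition dot x y : R := \sum_a x a ord0 * y a ord0.

(** Polarisation of the Clifford relation. *)
Lemma clif_anticomm x y :
  clif cl x *m clif cl y + clif cl y *m clif cl x = ((- 2 * dot x y)%:C)%:M.
Proof.
have := clif_sqr cl (x + y); rewrite clifD mulmxDl !mulmxDr !clif_sqr.
set X := _ *m _; set Y := _ *m _ => /eqP.
have -> : \sum_a (x + y) a ord0 ^+ 2 =
   \sum_a x a ord0 ^+ 2 + \sum_a y a ord0 ^+ 2 + 2 * dot x y.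
  rewrite /dot mulr_sumr -!big_split; apply: eq_bigr => a _ /=.
  by rewrite mxE; ring.
set p := \sum_a _; set q := \sum_a _ => /eqP e.
have -> : X + Y = (- p%:C)%:M + X + (Y + (- q%:C)%:M)
    - (- p%:C)%:M - (- q%:C)%:M.
  by mx_ring.
by rewrite e -!raddfB /=; congr (_%:M); ring.
Qed.

Lemma gam_anticomm a b :
  g a *m g b = - (g b *m g a) - (2 * (a == b)%:R) *:: 1%:M.
Proof.
have := clif_anticomm (delta_mx a ord0) (delta_mx b ord0).
rewrite !clif_delta => e; rewrite -[LHS](addrK (g b *m g a)) e addrC.
congr (_ + _); rewrite -scaleNr -rmorphN scalemx1.
congr (_%:C%:M); rewrite -mulNr; congr (_ * _).
rewrite /dot (bigD1 a) //= big1 => [|c ca]; last by rewrite mxE (negPf ca) mul0r.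
by rewrite !mxE !eqxx mul1r addr0 andbT.
Qed.

Definition cvec (f : 'I_n -> R) : 'M[R[i]]_N := \sum_a f a *:: g a.

Definition quad (L : 'I_n -> 'I_n -> R) : 'M[R[i]]_N :=
  \sum_a \sum_b L a b *:: (g a *m g b).

(** With [quad] and [cvec], the Clifford actions of tensors of rank 3, 2 and 1. *)
Definition cubic (L : 'I_n -> 'I_n -> 'I_n -> R) : 'M[R[i]]_N :=
  \sum_c \sum_a \sum_b L c a b *:: (g c *m g a *m g b).

Lemma cvecD f h : cvec (fun a => f a + h a) = cvec f + cvec h.
Proof.
rewrite /cvec -big_split; apply: eq_bigr => a _ /=.
by rewrite rmorphD scalerDl.
Qed.

Lemma cvecZ t f : cvec (fun a => t * f a) = t *:: cvec f.
Proof.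
rewrite /cvec scaler_sumr; apply: eq_bigr => a _ /=.
by rewrite rmorphM scalerA.
Qed.

Lemma cubicD L L' :
  cubic (fun c a b => L c a b + L' c a b) = cubic L + cubic L'.
Proof.
rewrite /cubic -big_split; apply: eq_bigr => c _ /=.
rewrite -big_split; apply: eq_bigr => a _ /=.
rewrite -big_split; apply: eq_bigr => b _ /=.
by rewrite rmorphD scalerDl.
Qed.

Lemma cubicN L : cubic (fun c a b => - L c a b) = - cubic L.
Proof.
rewrite /cubic -sumrN; apply: eq_bigr => c _ /=.
rewrite -sumrN; apply: eq_bigr => a _ /=.
rewrite -sumrN; apply: eq_bigr => b _ /=.
by rewrite rmorphN scaleNr.
Qed.

Lemma eq_cubic L L' : (forall c a b, L c a b = L' c a b) -> cubic L = cubic L'.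
Proof.
by move=> e; apply: eq_bigr => c _; apply: eq_bigr => a _; apply: eq_bigr => b _;
  rewrite e.
Qed.

Lemma gam_cycle a b c : g c *m g a *m g b = g a *m g b *m g c
  - (2 * (a == c)%:R) *:: g b + (2 * (b == c)%:R) *:: g a.
Proof.
rewrite (gam_anticomm c a) mulmxBl mulNmx -!scalemxAl mul1mx.
rewrite -[g a *m g c *m g b]mulmxA.
rewrite (gam_anticomm c b) mulmxBr mulmxN -!scalemxAr mulmx1.
rewrite [g a *m (g b *m g c)]mulmxA.
rewrite [c == a]eq_sym [c == b]eq_sym.
move: (g a *m g b *m g c) (g a) (g b) => X A B.
by mx_ring.
Qed.

(** A cyclic permutation of the three Clifford factors costs only vector terms.
    Adding the three cyclic permutations of a tensor therefore computes
    three times its Clifford action, up to traces. *)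
Lemma cubic_cycle L : cubic (fun c a b => L a b c) =
  cubic L + cvec (fun b => - 2 * \sum_a L a b a)
          + cvec (fun a => 2 * \sum_b L a b b).
Proof.
have -> : cubic (fun c a b => L a b c) =
    \sum_a \sum_b \sum_c L a b c *:: (g c *m g a *m g b).
  rewrite /cubic exchange_big; apply: eq_bigr => a _ /=.
  exact: exchange_big.
have -> : cvec (fun b => - 2 * \sum_a L a b a) =
    \sum_a \sum_b \sum_c (- (2 * (a == c)%:R * L a b c)) *:: g b.
  rewrite exchange_big; apply: eq_bigr => b _ /=.
  rewrite mulr_sumr rmorph_sum scaler_suml; apply: eq_bigr => a _ /=.
  rewrite (bigD1 a) //= big1 => [|c ca].
    by rewrite eqxx mulr1 addr0 -?mulNr.
  by rewrite eq_sym (negPf ca) mulr0 mul0r oppr0 scale0r.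
have -> : cvec (fun a => 2 * \sum_b L a b b) =
    \sum_a \sum_b \sum_c (2 * (b == c)%:R * L a b c) *:: g a.
  apply: eq_bigr => a _ /=.
  rewrite mulr_sumr rmorph_sum scaler_suml; apply: eq_bigr => b _ /=.
  rewrite (bigD1 b) //= big1 => [|c cb].
    by rewrite eqxx mulr1 addr0 -?mulNr.
  by rewrite eq_sym (negPf cb) mulr0 mul0r scale0r.
rewrite /cubic -!big_split; apply: eq_bigr => a _ /=.
rewrite -!big_split; apply: eq_bigr => b _ /=.
rewrite -!big_split; apply: eq_bigr => c _ /=.
rewrite gam_cycle; move: (g a *m g b *m g c) (g a) (g b) (a == c) (b == c)
  (L a b c) => X A B s t u.
by mx_ring.
Qed.

Variable Rm : 'I_n -> 'I_n -> 'M[R]_n.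
Local Notation F d c := (co_trace (Rm d c)).
Hypothesis Rm_skew : forall d c, Rm c d = - Rm d c.
Hypothesis Rm_co : forall d c, co (Rm d c).
Hypothesis Rm_bianchi : forall d c a e,
  Rm d c e a + Rm c a e d + Rm a d e c = 0.

(** For a matrix of co(n) the multiple of the identity in A + A^T is necessarily
    twice the normalised trace. *)
Lemma co_traceP (A : 'M[R]_n) : co A ->
  forall a b, A a b + A b a = 2 * co_trace A * (a == b)%:R.
Proof.
move=> [t At] a b; have e a' b' : A a' b' + A b' a' = t *+ (a' == b').
  by move/matrixP: At => /(_ a' b'); rewrite !mxE.
rewrite e -[t *+ _]mulr_natr; congr (_ * _).
have n0 : n%:R != 0 :> R by rewrite pnatr_eq0; case: (n) a => [[]|].
have tS : 2 * \tr A = n%:R * t.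
  rewrite /mxtrace mulr_sumr (eq_bigr (fun=> t)) => [|k _].
    by rewrite sumr_const card_ord mulr_natl.
  by have := e k k; rewrite eqxx mulr1n => <-; ring.
by rewrite /co_trace mulrA tS mulrC mulKf.
Qed.

(** The skew part of the endomorphism [Rm d c], with the second pair of indices
    in the order of <R(e_d, e_c) e_a, e_b>. *)
Definition Rm0 d c a b : R := Rm d c b a - F d c * (a == b)%:R.

Lemma Rm0_skewr d c a b : Rm0 d c b a = - Rm0 d c a b.
Proof.
have := co_traceP (Rm_co d c) a b; rewrite /Rm0 [b == a]eq_sym => e.
lra.
Qed.

Lemma co_trace_skew d c : F c d = - F d c.
Proof. by rewrite Rm_skew /co_trace raddfN mulNr. Qed.

(** The cyclic sum over the last three indices, whereas the Bianchi identity is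
    cyclic in the first three.  The two are exchanged as in the proof of the pair
    symmetry of a Riemannian curvature tensor: a combination of the four Bianchi
    identities on the four indices.  The F-terms measure the failure of skewness
    in the last pair. *)
Lemma Rm0_cycle d c a b : Rm0 d c a b + Rm0 d a b c + Rm0 d b c a =
  - (F c a * (d == b)%:R + F a b * (d == c)%:R + F b c * (d == a)%:R).
Proof.
have sk (x y i j : 'I_n) : Rm y x i j = - Rm x y i j by rewrite Rm_skew mxE.
have cs (x y i j : 'I_n) : Rm x y i j = 2 * F x y * (i == j)%:R - Rm x y j i.
  by rewrite -(co_traceP (Rm_co x y)) addrK.
have B1 := Rm_bianchi d c a b; have B2 := Rm_bianchi d a b c.
have B3 := Rm_bianchi d b c a; have B4 := Rm_bianchi c a b d.
rewrite /Rm0.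
(* Put both index pairs of every component in the order d, c, a, b. *)
rewrite ?(sk d c) ?(co_trace_skew d c) ?(sk d a) ?(co_trace_skew d a)
  ?(sk d b) ?(co_trace_skew d b) ?(sk c a) ?(co_trace_skew c a)
  ?(sk c b) ?(co_trace_skew c b) ?(sk a b) ?(co_trace_skew a b) in B1 B2 B3 B4 *.
rewrite ?(cs d c b a) [b == a]eq_sym in B1 B2 B3 B4 *.
rewrite ?(cs d a b c) [b == c]eq_sym in B1 B2 B3 B4 *.
rewrite ?(cs d b a c) [a == c]eq_sym in B1 B2 B3 B4 *.
rewrite ?(cs c a b d) [b == d]eq_sym in B1 B2 B3 B4 *.
rewrite ?(cs c b a d) [a == d]eq_sym in B1 B2 B3 B4 *.
rewrite ?(cs a b c d) [c == d]eq_sym in B1 B2 B3 B4 *.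
lra.
Qed.

Definition ricci d b : R := \sum_a Rm0 d a a b.

Lemma sum_delta (f : 'I_n -> R) d : \sum_a f a * (d == a)%:R = f d.
Proof.
rewrite (bigD1 d) //= big1 => [|a ad]; last by rewrite eq_sym (negPf ad) mulr0.
by rewrite eqxx mulr1 addr0.
Qed.

(** The Bianchi identity traced over its last two indices. *)
Lemma ricci_skew d c : ricci d c - ricci c d = (2 - n%:R) * F d c.
Proof.
have : \sum_a (F d c + (- Rm0 c a a d + F c a * (d == a)%:R)
    + (Rm0 d a a c - F d a * (c == a)%:R)) = 0.
  apply: big1 => a _.
  have := Rm_bianchi d c a a; have := co_traceP (Rm_co d c) a a.
  rewrite [Rm a d]Rm_skew mxE -(Rm0_skewr c a a d) (Rm0_skewr d a c a) /Rm0.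
  rewrite eqxx [_ * true%:R]mulr1; lra.
rewrite 4!big_split /= !sumrN sumr_const card_ord -/(ricci c d) -/(ricci d c).
rewrite !sum_delta (co_trace_skew d c) -[F d c *+ n]mulr_natl; lra.
Qed.

(** Subtracting the trace part removes the diagonal terms, so the restriction to
    distinct indices in [spin_lift] can be dropped. *)
Lemma spin_liftE (A : 'M[R]_n) : co A -> spin_lift cl A =
  4^-1 *:: quad (fun a b => A b a - co_trace A * (a == b)%:R).
Proof.
move=> cA; rewrite /spin_lift /quad fmorphV rmorph_nat; congr (_ *: _).
apply: eq_bigr => a _; rewrite [RHS](bigD1 a) //= eqxx.
have -> : A a a - co_trace A * 1 = 0.
  by have := co_traceP cA a a; rewrite eqxx [_ * true%:R]mulr1; lra.
rewrite scale0r add0r; apply: eq_bigr => b ba.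
by rewrite eq_sym (negPf ba) mulr0 subr0.
Qed.

Lemma quadZ t L : quad (fun a b => t * L a b) = t *:: quad L.
Proof.
rewrite /quad scaler_sumr; apply: eq_bigr => a _; rewrite scaler_sumr.
by apply: eq_bigr => b _; rewrite rmorphM scalerA.
Qed.

Lemma sum_gam_cvec h : \sum_d g d *m cvec (h d) = quad h.
Proof.
apply: eq_bigr => d _; rewrite mulmx_sumr; apply: eq_bigr => a _.
by rewrite -scalemxAr.
Qed.

Lemma quad_tr h :
  quad (fun a b => h b a) = - quad h - (2 * \sum_a h a a) *:: 1%:M.
Proof.
rewrite /quad exchange_big /= mulr_sumr rmorph_sum scaler_suml.
rewrite -!sumrN -big_split; apply: eq_bigr => a _ /=.
have -> : (2 * h a a) *:: 1%:M =
    \sum_b (2 * (a == b)%:R * h a b) *:: 1%:M :> 'M[R[i]]_N.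
  rewrite (bigD1 a) //= big1 => [|b ba]; last first.
    by rewrite eq_sym (negPf ba) mulr0 mul0r scale0r.
  by rewrite eqxx mulr1 addr0.
rewrite -!sumrN -big_split; apply: eq_bigr => b _ /=.
rewrite (gam_anticomm b a) [b == a]eq_sym.
move: (g a *m g b) 1%:M (2 * (a == b)%:R) (h a b) => X Y s t.
by mx_ring.
Qed.

(** A symmetric tensor acts by its trace alone. *)
Lemma quad_skew h : quad h =
  2^-1 *:: quad (fun a b => h a b - h b a) - (\sum_a h a a) *:: 1%:M.
Proof.
have -> : quad (fun a b => h a b - h b a) = quad h - quad (fun a b => h b a).
  rewrite /quad -sumrB; apply: eq_bigr => a _; rewrite -sumrB.
  by apply: eq_bigr => b _; rewrite rmorphB scalerBl.
rewrite (quad_tr h); exact: skew_part.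
Qed.

(** The sum of the three cyclic permutations of [cubic (Rm0 d)] is computed in two
    ways: by [cubic_cycle] it is three times the unknown plus Ricci terms, and by
    the cyclic identity [Rm0_cycle] it is minus the same sum for the tensor e_d (x) F,
    where [cubic_cycle] applies once more. *)
Lemma cubic_Rm0 d : cubic (Rm0 d) =
  - (g d *m quad (fun a b => F a b)) - 2 *:: cvec (fun a => F d a) - 2 *:: cvec (ricci d).
Proof.
have zero f : (forall a, f a = 0) -> cvec f = 0.
  by move=> f0; rewrite /cvec big1 // => a _; rewrite f0 scale0r.
have Faa a : F a a = 0 by have := co_trace_skew a a; lra.
have K0aa c a : Rm0 d c a a = 0 by have := Rm0_skewr d c a a; lra.
have eqv f h : f =1 h -> cvec f = cvec h by move=> /funext ->.
pose L := Rm0 d.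
have cL1 : cubic (fun c a b => L a b c) = cubic L + 2 *:: cvec (ricci d).
  rewrite cubic_cycle [X in _ + X]zero ?addr0 => [|a]; last first.
    by rewrite /= big1 ?mulr0 // => b _; rewrite K0aa.
  rewrite -cvecZ; congr (_ + _); apply: eqv => b.
  rewrite /ricci !mulr_sumr; apply: eq_bigr => a _.
  by rewrite /L Rm0_skewr; ring.
have cL2 : cubic (fun c a b => L b c a) = cubic L + 4 *:: cvec (ricci d).
  rewrite (cubic_cycle (fun c a b => L a b c)) cL1.
  rewrite [X in _ + X + _]zero ?addr0 => [|b]; last first.
    by rewrite /= big1 ?mulr0 // => a _; rewrite /L K0aa.
  rewrite -addrA; congr (_ + _).
  by rewrite scale4; congr (_ + _); rewrite -cvecZ; apply: eqv.
pose P c a b := F a b * (d == c)%:R.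
have cP : cubic P = g d *m quad (fun a b => F a b).
  rewrite /cubic (bigD1 d) //= [X in _ + X]big1 ?addr0 => [|c cd]; last first.
    apply: big1 => a _; apply: big1 => b _.
    by rewrite /P eq_sym (negPf cd) mulr0 scale0r.
  rewrite mulmx_sumr; apply: eq_bigr => a _; rewrite mulmx_sumr.
  by apply: eq_bigr => b _; rewrite /P eqxx mulr1 -scalemxAr mulmxA.
have cP1 : cubic (fun c a b => P a b c) = cubic P + 2 *:: cvec (fun a => F d a).
  rewrite cubic_cycle [X in _ + X]zero ?addr0 => [|a]; last first.
    by rewrite /= big1 ?mulr0 // => b _; rewrite /P Faa mul0r.
  rewrite -cvecZ; congr (_ + _); apply: eqv => b.
  rewrite (bigD1 d) //= big1 ?addr0 => [|c cd]; last first.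
    by rewrite /P eq_sym (negPf cd) mulr0.
  by rewrite /P eqxx mulr1 (co_trace_skew d b) mulNr mulrN opprK.
have cP2 : cubic (fun c a b => P b c a) = cubic P + 4 *:: cvec (fun a => F d a).
  rewrite (cubic_cycle (fun c a b => P a b c)) cP1.
  rewrite [X in _ + X + _]zero ?addr0 => [|b]; last first.
    by rewrite /= big1 ?mulr0 // => a _; rewrite /P Faa mul0r.
  rewrite -addrA; congr (_ + _).
  rewrite scale4; congr (_ + _); rewrite -cvecZ; apply: eqv => a.
  congr (_ * _); rewrite (bigD1 d) //= big1 ?addr0 => [|c cd]; last first.
    by rewrite /P eq_sym (negPf cd) mulr0.
  by rewrite /P eqxx mulr1.
have : cubic L + cubic (fun c a b => L a b c) + cubic (fun c a b => L b c a) =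
    - (cubic P + cubic (fun c a b => P a b c) + cubic (fun c a b => P b c a)).
  rewrite -!cubicD -cubicN; apply: eq_cubic => c a b.
  rewrite /L Rm0_cycle /P; congr (- _); ring.
rewrite cL1 cL2 cP1 cP2 cP -/L.
exact: third_part.
Qed.

Lemma gam_sqr a : g a *m g a = - 1%:M.
Proof.
by apply: sqr_part; rewrite {1}gam_anticomm eqxx mulr1.
Qed.

Local Notation sg d c := (spin_lift cl (Rm d c)).
Local Notation G := (quad (fun a b => F a b)).

(** The first two terms are - 1/4 times the trivector part of e_d . F; for a
    Riemannian curvature only the Ricci vector is left. *)
Lemma sum_gam_spin_lift d : \sum_c g c *m sg d c =
  - (4^-1 *:: (g d *m G)) - 2^-1 *:: cvec (fun a => F d a)
  - 2^-1 *:: cvec (ricci d).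
Proof.
rewrite -quarter_part -cubic_Rm0 /cubic scaler_sumr; apply: eq_bigr => c _.
rewrite spin_liftE // -scalemxAr /quad mulmx_sumr; congr (_ *: _).
apply: eq_bigr => a _; rewrite mulmx_sumr; apply: eq_bigr => b _.
by rewrite -scalemxAr mulmxA.
Qed.

(** Two F-terms add up: one from the trivector part of the single contraction, one
    from the skew part of the Ricci tensor. *)
Lemma sum_gam_sum_gam_spin_lift :
  \sum_d g d *m (\sum_c g c *m sg d c) =
  ((n%:R - 2) / 2) *:: G + ((\sum_d ricci d d) / 2) *:: 1%:M.
Proof.
have eq1 d : g d *m (\sum_c g c *m sg d c) = 4^-1 *:: G
    - 2^-1 *:: (g d *m cvec (fun a => F d a)) - 2^-1 *:: (g d *m cvec (ricci d)).
  rewrite sum_gam_spin_lift !mulmxBr mulmxN -!scalemxAr mulmxA gam_sqr.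
  by rewrite mulNmx mul1mx scalerN opprK.
rewrite (eq_bigr _ (fun d _ => eq1 d)) !sumrB -!scaler_sumr !sum_gam_cvec.
rewrite sumr_const card_ord [quad ricci]quad_skew.
have -> : quad (fun a b => ricci a b - ricci b a) = (2 - n%:R) *:: G.
  rewrite -quadZ; apply: eq_bigr => a _; apply: eq_bigr => b _.
  by rewrite ricci_skew.
have -> : (4^-1)%:C *: (G *+ n) = (n%:R / 4) *:: G.
  by rewrite -[G *+ n]scaler_nat scalerA rmorphM rmorph_nat mulrC.
exact: ricci_part.
Qed.

Section TwistorIntegrability.
Variables (w : R) (b : 'I_n -> 'I_n -> R).
Variables (psi : 'cV[R[i]]_N) (dphi : 'I_n -> 'cV[R[i]]_N).
Hypothesis n3 : (3 <= n)%N.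
Hypothesis integrability : forall d c,
  ((w * F d c) *:: 1%:M + sg d c) *m psi =
  - (n%:R^-1 *:: (g c *m dphi d - g d *m dphi c)).
Hypothesis reduction : forall d,
  (w - 2^-1) *:: (cvec (fun a => F d a) *m psi +
    (2 * (n%:R - 1))^-1 *:: (g d *m (G *m psi))) = cvec (b d) *m psi.

(** The real tensor whose rows are the vectors eta with nabla_d phi = eta . psi: a
    Schouten tensor of the Weyl structure, corrected by B. *)
Definition twistor_schouten d a : R := n%:R / (n%:R - 2) *
  (b d a + (- 2^-1 * ricci d a +
     (\sum_e ricci e e) / (4 * (n%:R - 1)) * (d == a)%:R)).

Let Dphi := \sum_c g c *m dphi c.

Let n1 : n%:R != 0 :> R. Proof. by rewrite pnatr_eq0; case: (n) n3. Qed.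
Let n2 : n%:R - 1 != 0 :> R.
Proof. by rewrite subr_eq0 -[1]/(1%:R) eqr_nat; case: (n) n3 => [|[]]. Qed.
Let n4 : n%:R - 2 != 0 :> R.
Proof. by rewrite subr_eq0 eqr_nat; case: (n) n3 => [|[|[]]]. Qed.

Let contraction d := \sum_c g c *m (((w * F d c) *:: 1%:M + sg d c) *m psi).

Lemma sum_gam_integrability d :
  contraction d = (1 - 2 / n%:R) *:: dphi d - n%:R^-1 *:: (g d *m Dphi).
Proof.
have e c : g c *m (((w * F d c) *:: 1%:M + sg d c) *m psi) =
    n%:R^-1 *:: dphi d - n%:R^-1 *:: (g d *m (g c *m dphi c))
    - (2 / n%:R * (d == c)%:R) *:: dphi c.
  rewrite integrability mulmxN -scalemxAr mulmxBr !mulmxA gam_sqr.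
  rewrite (gam_anticomm c d) mulmxBl !mulNmx -scalemxAl !mul1mx.
  rewrite [c == d]eq_sym; move: (g d *m g c *m dphi c) (dphi d) (dphi c) (d == c) n%:R^-1.
  by move=> X Y Z s t; mx_ring.
rewrite /contraction (eq_bigr _ (fun c _ => e c)) !sumrB -!scaler_sumr -mulmx_sumr.
rewrite sumr_const card_ord -/Dphi.
have -> : \sum_c (2 / n%:R * (d == c)%:R) *:: dphi c = (2 / n%:R) *:: dphi d.
  rewrite (bigD1 d) //= big1 ?addr0 => [|c cd]; first by rewrite eqxx mulr1.
  by rewrite eq_sym (negPf cd) mulr0 scale0r.
have -> : n%:R^-1 *:: (dphi d *+ n) = dphi d.
  rewrite -[dphi d *+ n]scaler_nat scalerA -(rmorph_nat (real_complex R)).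
  by rewrite -rmorphM mulVf // scale1r.
rewrite rmorphB scalerBl scale1r.
by rewrite addrAC.
Qed.

Lemma sum_gam_sum_gam_integrability :
  \sum_d g d *m contraction d = (2 - 2 / n%:R) *:: Dphi.
Proof.
under eq_bigr => d _ do
  rewrite sum_gam_integrability mulmxBr -!scalemxAr mulmxA gam_sqr mulNmx
    mul1mx scalerN opprK.
rewrite big_split -scaler_sumr -/Dphi sumr_const card_ord /=.
have -> : n%:R^-1 *:: Dphi *+ n = Dphi.
  rewrite -[_ *+ n]scaler_nat scalerA -(rmorph_nat (real_complex R)).
  by rewrite -rmorphM mulfV // scale1r.
move: Dphi => X; mx_ring.
Qed.

Lemma contractionE d : contraction d = w *:: (cvec (fun a => F d a) *m psi) +
  (\sum_c g c *m sg d c) *m psi.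
Proof.
rewrite /contraction /cvec !mulmx_suml scaler_sumr -big_split; apply: eq_bigr => c _ /=.
move: (sg d c) => S; rewrite mulmxDl mulmxDr -!scalemxAl mul1mx -scalemxAr.
by rewrite scalerA rmorphM mulmxA.
Qed.

(** The double contraction determines the full Clifford contraction of nabla phi;
    the single one then determines nabla phi. *)
Lemma nabla_phi_clifford d : dphi d = cvec (twistor_schouten d) *m psi.
Proof.
have h1 := sum_gam_integrability d.
have h2 : (2 - 2 / n%:R) *:: (g d *m Dphi) = w *:: (g d *m (G *m psi)) +
   (((n%:R - 2) / 2) *:: (g d *m (G *m psi)) +
    ((\sum_e ricci e e) / 2) *:: (g d *m psi)).
  rewrite scalemxAr -sum_gam_sum_gam_integrability.
  under eq_bigr => e _ do rewrite contractionE mulmxDr -scalemxAr !mulmxA.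
  rewrite big_split -scaler_sumr -!mulmx_suml sum_gam_cvec /=.
  by rewrite sum_gam_sum_gam_spin_lift mulmxDl -!scalemxAl mul1mx !mulmxDr -!scalemxAr.
have h3 := contractionE d; rewrite sum_gam_spin_lift !mulmxBl mulNmx -!scalemxAl in h3.
rewrite -mulmxA in h3.
have -> : cvec (twistor_schouten d) *m psi = (n%:R / (n%:R - 2)) *::
   (cvec (b d) *m psi + (- 2^-1 *:: (cvec (ricci d) *m psi) +
      (\sum_e ricci e e) / (4 * (n%:R - 1)) *:: (g d *m psi))).
  rewrite /twistor_schouten cvecZ -scalemxAl !cvecD !mulmxDl !cvecZ -!scalemxAl.
  have -> // : cvec (fun a => (d == a)%:R) = g d.
  rewrite /cvec (bigD1 d) //= big1 ?addr0 => [|c cd]; first by rewrite eqxx scale1r.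
  by rewrite eq_sym (negPf cd) scale0r.
apply: schouten_part n1 n2 n4 h1 h2 h3 (reduction d).
Qed.
End TwistorIntegrability.

End CliffordAlgebra.

(** * Spin group, spin connection and the algebra of twistor spinors *)

Section Hermitian.
Variables (R : realType) (n : nat) (cl : clifford_module R n).
Local Notation N := (spin_dim n).
Local Notation "x *:: X" := (x%:C *: X) (at level 40).
Local Notation g := (gam cl).
Local Notation h := (hprod cl).
Implicit Types (u v : 'cV[R[i]]_N) (S : 'M[R[i]]_N) (x : 'cV[R]_n).

Lemma hprodDl u u' v : h (u + u') v = h u v + h u' v.
Proof. by rewrite /hprod mulmxDr mxE. Qed.

Lemma hprodZl a u v : h (a *: u) v = a * h u v.
Proof. by rewrite /hprod -scalemxAr mxE. Qed.

Lemma hprodDr u v v' : h u (v + v') = h u v + h u v'.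
Proof. by rewrite /hprod map_mxD linearD /= !mulmxDl mxE. Qed.

Lemma hprodZr a u v : h u (a *: v) = conjc a * h u v.
Proof. by rewrite /hprod map_mxZ linearZ /= -!scalemxAl mxE. Qed.

Lemma hprodNr u v : h u (- v) = - h u v.
Proof. by rewrite -scaleN1r hprodZr rmorphN rmorph1 mulN1r. Qed.

Lemma hprod0r u : h u 0 = 0.
Proof. by rewrite -(scale0r (0 : 'cV[R[i]]_N)) hprodZr rmorph0 mul0r. Qed.

Lemma hprod_sumr (I : Type) (r : seq I) (P : pred I) (F : I -> 'cV[R[i]]_N) u :
  h u (\sum_(i <- r | P i) F i) = \sum_(i <- r | P i) h u (F i).
Proof. by apply: (big_morph (h u)) => [v v'|]; rewrite ?hprodDr ?hprod0r. Qed.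

Lemma gam_skew a u v : h (g a *m u) v = - h u (g a *m v).
Proof. by rewrite -clif_delta clif_skew. Qed.

Lemma ReZ (t : R) (z : R[i]) : complex.Re (t%:C * z) = t * complex.Re z.
Proof. by case: z => a b /=; rewrite mul0r subr0. Qed.

Lemma Re_hprodC u v : complex.Re (h u v) = complex.Re (h v u).
Proof. by rewrite hprod_sym; case: (h v u). Qed.

Lemma clif_sqr1 x : \sum_a x a ord0 ^+ 2 = 1 ->
  clif cl x *m clif cl x = - 1%:M.
Proof. by move=> x1; rewrite clif_sqr x1 raddfN. Qed.

Lemma clif_unit x : \sum_a x a ord0 ^+ 2 = 1 -> clif cl x \in unitmx.
Proof.
move=> /clif_sqr1 x1; apply: (@mulmx1_unit _ _ _ (- clif cl x) _).1.
by rewrite mulmxN x1 opprK.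
Qed.

Lemma hprod_clif x u v : \sum_a x a ord0 ^+ 2 = 1 ->
  h (clif cl x *m u) (clif cl x *m v) = h u v.
Proof.
move=> /clif_sqr1 x1.
by rewrite clif_skew mulmxA x1 mulNmx mul1mx hprodNr opprK.
Qed.

(** Even products of unit vectors are unitary, since each unit vector squares
    to -1 and is skew-hermitian. *)
Lemma Spin_unitary S : Spin cl S ->
  S \in unitmx /\ forall u v, h (S *m u) (S *m v) = h u v.
Proof.
move=> [xs [_ xs1 ->]]; elim: xs xs1 => [|x xs IH] xs1 /=.
  by split=> [|u v]; rewrite ?unitmx1 // !mul1mx.
have xs1' y : y \in xs -> \sum_a y a ord0 ^+ 2 = 1.
  by move=> yxs; apply: xs1; rewrite in_cons yxs orbT.
have [uS hS] := IH xs1'.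
have x1 := xs1 x (mem_head _ _).
split=> [|u v]; first by rewrite unitmx_mul clif_unit.
by rewrite -!mulmxA hprod_clif.
Qed.

Lemma hprod_Spin_inv S u v : Spin cl S ->
  h (invmx S *m u) (invmx S *m v) = h u v.
Proof.
move=> /Spin_unitary [uS hS].
by rewrite -[LHS]hS !mulmxA mulmxV // !mul1mx.
Qed.

(** The opposite of the reflection in the hyperplane orthogonal to [x]. *)
Definition mx_reflect (x : 'cV[R]_n) : 'M[R]_n := 2 *: (x *m x^T) - 1%:M.

Lemma mx_reflect_orth x : \sum_a x a ord0 ^+ 2 = 1 ->
  mx_reflect x *m (mx_reflect x)^T = 1%:M.
Proof.
move=> x1; have xx : x^T *m x = 1%:M.
  apply/matrixP=> i j; rewrite (ord1 i) (ord1 j) !mxE -x1.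
  by apply: eq_bigr => a _; rewrite mxE expr2.
rewrite /mx_reflect linearB linearZ /= trmx_mul trmxK trmx1.
rewrite mulmxBl mul1mx mulmxBr mulmx1 -scalemxAl -scalemxAr.
rewrite mulmxA -[x *m x^T *m x]mulmxA xx mulmx1.
move: (x *m x^T) 1%:M => X Y; apply/matrixP=> i j.
by do ?[rewrite mxD | rewrite mxN | rewrite mxZ]; ring.
Qed.

(** The sign is the one of conjugation, x y x^-1, as opposed to the twisted
    conjugation giving the reflection itself. *)
Lemma mx_reflect_lambda x : \sum_a x a ord0 ^+ 2 = 1 ->
  is_lambda cl (clif cl x) (mx_reflect x).
Proof.
move=> x1 y.
have -> : mx_reflect x *m y = (2 * dot x y) *: x - y.
  rewrite mulmxBl mul1mx -scalemxAl -mulmxA -scalerA; congr (_ *: _ - _).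
  apply/matrixP=> i j; rewrite (ord1 j) [RHS]mxE !mxE big_ord1 mulrC.
  by congr (_ * _); rewrite mxE; apply: eq_bigr => a _; rewrite mxE.
have -> : clif cl ((2 * dot x y) *: x - y) =
    (2 * dot x y) *:: clif cl x - clif cl y.
  by rewrite clifD clifZ -scaleN1r clifZ rmorphN rmorph1 scaleN1r.
rewrite mulmxBl -scalemxAl clif_sqr1 // scalerN.
have := clif_anticomm cl x y => /eqP; rewrite eq_sym -subr_eq => /eqP <-.
by rewrite -scaleNr -rmorphN scalemx1 mulNr.
Qed.

Lemma Spin_lambda S : Spin cl S ->
  exists A, is_lambda cl S A /\ A *m A^T = 1%:M.
Proof.
move=> [xs [_ xs1 ->]]; elim: xs xs1 => [|x xs IH] xs1 /=.
  by exists 1%:M; split=> [y|]; rewrite ?trmx1 ?mulmx1 ?mul1mx.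
have xs1' y : y \in xs -> \sum_a y a ord0 ^+ 2 = 1.
  by move=> yxs; apply: xs1; rewrite in_cons yxs orbT.
have [A [lA oA]] := IH xs1'.
have x1 := xs1 x (mem_head _ _).
exists (mx_reflect x *m A); split=> [y|].
  by rewrite -[LHS]mulmxA lA [LHS]mulmxA mx_reflect_lambda // -!mulmxA.
by rewrite trmx_mul mulmxA -[_ *m A *m _]mulmxA oA mulmx1 mx_reflect_orth.
Qed.
End Hermitian.

Section SpinConnection.
Variables (R : realType) (n : nat) (cl : clifford_module R n).
Local Notation N := (spin_dim n).
Local Notation "x *:: X" := (x%:C *: X) (at level 40).
Local Notation g := (gam cl).
Local Notation h := (hprod cl).
Local Notation sg := (spin_lift cl).
Implicit Types (A B : 'M[R]_n).

(** For A in co(n), the component in so(n). *)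
Definition so_part A : 'M[R]_n := A - (co_trace A)%:M.

Lemma co_traceD A B : co_trace (A + B) = co_trace A + co_trace B.
Proof. by rewrite /co_trace raddfD mulrDl. Qed.

Lemma co_traceZ t A : co_trace (t *: A) = t * co_trace A.
Proof. by rewrite /co_trace linearZ mulrA. Qed.

Lemma co_traceN A : co_trace (- A) = - co_trace A.
Proof. by rewrite /co_trace raddfN mulNr. Qed.

Lemma co_trace0 : co_trace (0 : 'M[R]_n) = 0.
Proof. by rewrite /co_trace raddf0 mul0r. Qed.

Lemma coD A B : co A -> co B -> co (A + B).
Proof.
move=> [s As] [t Bt]; exists (s + t).
by rewrite linearD /= addrACA As Bt -raddfD.
Qed.

Lemma coZ t A : co A -> co (t *: A).
Proof.
move=> [s As]; exists (t * s).
by rewrite linearZ /= -scalerDr As scale_scalar_mx.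
Qed.

Lemma coN A : co A -> co (- A).
Proof. by move=> cA; rewrite -scaleN1r; exact: coZ. Qed.

Lemma co0 : co (0 : 'M[R]_n).
Proof. by exists 0; rewrite trmx0 addr0 raddf0. Qed.

Lemma co_sum (F : 'I_n -> 'M[R]_n) : (forall a, co (F a)) ->
  co (\sum_a F a).
Proof. by move=> cF; elim/big_ind: _ => [|B C cB cC|a _]; [exact: co0|exact: coD|]. Qed.

Lemma so_part_skew A : co A -> (so_part A)^T = - so_part A.
Proof.
move=> cA; apply/matrixP=> a b; have := co_traceP cA a b.
rewrite /so_part !mxE [b == a]eq_sym mulr_natr mulrnAl -mulr_natr.
rewrite -[co_trace A *+ _]mulr_natr => e.
lra.
Qed.

Lemma co_commutator A B :
  A *m B - B *m A = so_part A *m so_part B - so_part B *m so_part A.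
Proof.
rewrite /so_part !mulmxBl !mulmxBr !mul_scalar_mx !mul_mx_scalar.
rewrite !scale_scalar_mx [co_trace B * _]mulrC.
move: (A *m B) (B *m A) (_%:M) => X Y Z.
by apply/matrixP=> i j; do ?[rewrite mxD | rewrite mxN | rewrite mxZ]; ring.
Qed.

Lemma co_trace_commutator A B : co_trace (A *m B - B *m A) = 0.
Proof. by rewrite /co_trace raddfB /= [\tr (A *m B)]mxtrace_mulC subrr mul0r. Qed.

Lemma coC A B : co A -> co B -> co (A *m B - B *m A).
Proof.
move=> cA cB; exists 0; rewrite co_commutator.
rewrite [(_ - _)^T]linearB /= !trmx_mul !so_part_skew // !mulmxN !mulNmx !opprK.
by rewrite addrA subrK subrr raddf0.
Qed.

Lemma spin_liftD A B : sg (A + B) = sg A + sg B.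
Proof.
rewrite /spin_lift -scalerDr -big_split; congr (_ *: _); apply: eq_bigr => a _.
rewrite -big_split; apply: eq_bigr => b _ /=.
by rewrite mxE rmorphD scalerDl.
Qed.

Lemma spin_liftZ t A : sg (t *: A) = t *:: sg A.
Proof.
rewrite /spin_lift [RHS]scalerA [in RHS]mulrC -scalerA; congr (_ *: _).
rewrite scaler_sumr; apply: eq_bigr => a _.
rewrite scaler_sumr; apply: eq_bigr => b _ /=.
by rewrite mxE rmorphM scalerA.
Qed.

Lemma spin_lift_so A : co A ->
  sg A = 4^-1 *:: quad cl (fun a b => so_part A b a).
Proof.
move=> cA; rewrite spin_liftE //; congr (_ *: _).
apply: eq_bigr => a _; apply: eq_bigr => b _.
by rewrite /so_part !mxE mulr_natr eq_sym.
Qed.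

Lemma gam_bracket a b c : g a *m g b *m g c - g c *m (g a *m g b) =
  (2 * (a == c)%:R) *:: g b - (2 * (b == c)%:R) *:: g a.
Proof.
rewrite mulmxA (gam_cycle cl a b c).
move: (g a *m g b *m g c) (_ *:: g b) (_ *:: g a) => X Y Z.
by mx_ring.
Qed.

(** [spin_lift] is the derivative of the covering: its commutator with Clifford
    multiplication by a vector is the action of the skew part on the vector. *)
Lemma spin_lift_gam A c : co A ->
  sg A *m g c = g c *m sg A + cvec cl (fun a => so_part A a c).
Proof.
move=> cA; have sk a b : so_part A b a = - so_part A a b.
  by have /matrixP /(_ a b) := so_part_skew cA; rewrite !mxE.
rewrite spin_lift_so // -scalemxAl -scalemxAr.
suff -> : quad cl (fun a b => so_part A b a) *m g c =
    g c *m quad cl (fun a b => so_part A b a) +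
    4 *:: cvec cl (fun a => so_part A a c).
  rewrite scalerDr scalerA -rmorphM mulVf ?pnatr_eq0 // scale1r //.
apply/eqP; rewrite addrC -subr_eq; apply/eqP.
transitivity (\sum_a \sum_b so_part A b a *::
   ((2 * (a == c)%:R) *:: g b - (2 * (b == c)%:R) *:: g a)).
  rewrite /quad mulmx_suml mulmx_sumr -sumrB; apply: eq_bigr => a _.
  rewrite mulmx_suml mulmx_sumr -sumrB; apply: eq_bigr => b _.
  by rewrite -gam_bracket scalerBr -scalemxAl -scalemxAr.
have -> : 4 *:: cvec cl (fun a => so_part A a c) =
    2 *:: cvec cl (fun a => so_part A a c) - 2 *:: cvec cl (fun a => so_part A c a).
  rewrite scale4; congr (_ + _); rewrite -scalerN; congr (_ *: _).
  rewrite /cvec -sumrN; apply: eq_bigr => a _.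
  by rewrite sk rmorphN scaleNr.
rewrite -!cvecZ.
under eq_bigr => a _ do under eq_bigr => b _ do rewrite scalerBr.
under eq_bigr => a _ do rewrite sumrB.
rewrite sumrB; congr (_ - _).
  rewrite exchange_big; apply: eq_bigr => b _ /=.
  rewrite (bigD1 c) //= big1 ?addr0 => [|a ac].
    by rewrite eqxx mulr1 scalerA -rmorphM mulrC.
  by rewrite (negPf ac) mulr0 scale0r scaler0.
apply: eq_bigr => a _ /=.
rewrite (bigD1 c) //= big1 ?addr0 => [|b bc].
  by rewrite eqxx mulr1 scalerA -rmorphM mulrC.
by rewrite (negPf bc) mulr0 scale0r scaler0.
Qed.

Lemma quad_cvecl (L : 'I_n -> 'I_n -> R) (C : 'M[R]_n) :
  \sum_a \sum_b L a b *:: (cvec cl (fun e => C e a) *m g b) =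
  quad cl (fun a b => \sum_e C a e * L e b).
Proof.
transitivity (\sum_a \sum_b \sum_e (C e a * L a b) *:: (g e *m g b)).
  apply: eq_bigr => a _; apply: eq_bigr => b _.
  rewrite /cvec mulmx_suml scaler_sumr; apply: eq_bigr => e _.
  by rewrite -scalemxAl scalerA -rmorphM mulrC.
under eq_bigr => a _ do rewrite exchange_big.
rewrite exchange_big; apply: eq_bigr => e _ /=.
rewrite exchange_big; apply: eq_bigr => b _ /=.
by rewrite rmorph_sum scaler_suml.
Qed.

Lemma quad_cvecr (L : 'I_n -> 'I_n -> R) (C : 'M[R]_n) :
  \sum_a \sum_b L a b *:: (g a *m cvec cl (fun e => C e b)) =
  quad cl (fun a b => \sum_e L a e * C b e).
Proof.
apply: eq_bigr => a _ /=.
transitivity (\sum_b \sum_e (L a b * C e b) *:: (g a *m g e)).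
  apply: eq_bigr => b _.
  rewrite /cvec mulmx_sumr scaler_sumr; apply: eq_bigr => e _.
  by rewrite -scalemxAr scalerA -rmorphM.
rewrite exchange_big; apply: eq_bigr => e _ /=.
by rewrite rmorph_sum scaler_suml.
Qed.

(** Follows from [spin_lift_gam] since commutation with a fixed element is a
    derivation of the Clifford algebra. *)
Lemma spin_lift_commutator A B : co A -> co B ->
  sg (A *m B - B *m A) = sg A *m sg B - sg B *m sg A.
Proof.
move=> cA cB; have cC := coC cA cB.
have sk a b : so_part A b a = - so_part A a b.
  by have /matrixP /(_ a b) := so_part_skew cA; rewrite !mxE.
have soC : so_part (A *m B - B *m A) = A *m B - B *m A.
  by rewrite /so_part co_trace_commutator raddf0 subr0.
rewrite (spin_lift_so cC) soC co_commutator (spin_lift_so cB).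
move: (so_part B) => B0.
rewrite -scalemxAr -scalemxAl -scalerBr; congr (_ *: _).
transitivity (\sum_a \sum_b B0 b a *::
   (cvec cl (fun e => so_part A e a) *m g b) +
   \sum_a \sum_b B0 b a *:: (g a *m cvec cl (fun e => so_part A e b))); last first.
  rewrite /quad !mulmx_suml !mulmx_sumr -sumrB -big_split.
  apply: eq_bigr => a _ /=.
  rewrite !mulmx_suml !mulmx_sumr -sumrB -big_split.
  apply: eq_bigr => b _ /=.
  rewrite -scalerDr -scalemxAl -scalemxAr -scalerBr; congr (_ *: _).
  rewrite mulmxA spin_lift_gam // mulmxDl -!mulmxA spin_lift_gam // mulmxDr.
  move: (g a *m (g b *m _)) (cvec _ _ *m _) (g a *m cvec _ _) => X Y Z.
  by mx_ring.
rewrite (quad_cvecl (fun a b => B0 b a)) (quad_cvecr (fun a b => B0 b a)).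
rewrite /quad -big_split; apply: eq_bigr => a _ /=.
rewrite -big_split; apply: eq_bigr => b _ /=.
rewrite -scalerDl -rmorphD; congr (_%:C *: _).
rewrite !mxE addrC -sumrN; congr (_ + _); apply: eq_bigr => e _.
  by rewrite [in RHS]sk mulNr mulrC.
exact: mulrC.
Qed.

(** The action of a matrix of co(n) on spinors of weight [w]. *)
Definition spin_conn (w : R) A : 'M[R[i]]_N :=
  (w * co_trace A)%:C%:M + sg A.

Lemma spin_connD w A B : spin_conn w (A + B) = spin_conn w A + spin_conn w B.
Proof.
by rewrite /spin_conn co_traceD mulrDr rmorphD raddfD spin_liftD addrACA.
Qed.

Lemma spin_connZ w t A : spin_conn w (t *: A) = t *:: spin_conn w A.
Proof.
rewrite /spin_conn co_traceZ spin_liftZ scalerDr; congr (_ + _).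
by rewrite mulrCA rmorphM scale_scalar_mx.
Qed.

Lemma spin_connN w A : spin_conn w (- A) = - spin_conn w A.
Proof. by rewrite -scaleN1r spin_connZ rmorphN rmorph1 scaleN1r. Qed.

Lemma spin_conn0 w : spin_conn w 0 = 0.
Proof. by rewrite -(scale0r (0 : 'M[R]_n)) spin_connZ scale0r. Qed.

Lemma spin_conn_sum w (F : 'I_n -> 'M[R]_n) :
  spin_conn w (\sum_a F a) = \sum_a spin_conn w (F a).
Proof.
apply: (big_morph (spin_conn w)) => [A B|]; first exact: spin_connD.
exact: spin_conn0.
Qed.

Lemma spin_connC w A B : co A -> co B -> spin_conn w (A *m B - B *m A) =
  spin_conn w A *m spin_conn w B - spin_conn w B *m spin_conn w A.
Proof.
move=> cA cB; rewrite /spin_conn co_trace_commutator mulr0 raddf0 add0r.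
rewrite (spin_lift_commutator cA cB); move: (sg A) (sg B) => S T.
rewrite !mulmxDl !mulmxDr !mul_scalar_mx.
rewrite !mul_mx_scalar !scale_scalar_mx [(w * co_trace B)%:C * _]mulrC.
move: (S *m T) (T *m S) (_%:M) => X Y Z.
by mx_ring.
Qed.

(** The identity part of [A] acts on the frame vector e_c as on a vector of weight
    one, and the weight of the spinor drops by one to compensate. *)
Lemma spin_conn_gam w A c : co A -> spin_conn w A *m g c =
  g c *m spin_conn (w - 1) A + cvec cl (fun a => A a c).
Proof.
move=> cA; rewrite /spin_conn mulmxDl mulmxDr mul_scalar_mx mul_mx_scalar.
rewrite spin_lift_gam //.
have -> : cvec cl (fun a => so_part A a c) =
    cvec cl (fun a => A a c) - co_trace A *:: g c.
  rewrite -(clif_delta cl c).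
  have -> : clif cl (delta_mx c ord0) = cvec cl (fun a => (a == c)%:R).
    by apply: eq_bigr => a _; rewrite mxE andbT.
  rewrite -cvecZ -scaleN1r -(rmorph1 (real_complex R)) -rmorphN -cvecZ -cvecD.
  by apply: eq_bigr => a _; rewrite /so_part !mxE mulr_natr mulN1r.
rewrite mulrBl mul1r.
move: (g c *m sg A) (g c) (cvec _ _) => X Y Z.
by mx_ring.
Qed.

Section Integrability.
Variables (w : R) (A : 'I_n -> 'M[R]_n) (dA : 'I_n -> 'I_n -> 'M[R]_n).
Variables (psi phi : 'cV[R[i]]_N) (dpsi dphi : 'I_n -> 'cV[R[i]]_N).
Variable (ddpsi : 'I_n -> 'I_n -> 'cV[R[i]]_N).
Hypothesis cA : forall c, co (A c).

(** For a torsion-free connection, the coefficient of E_e in the bracket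
    [E_d, E_c]. *)
Definition torsion_coef e d c : R := A d e c - A c e d.

(** The curvature of the connection form on the pair (E_d, E_c) of frame fields,
    when [dA d c] is the derivative along E_d of the matrix [A c]. *)
Definition curvature d c : 'M[R]_n :=
  dA d c - dA c d + (A d *m A c - A c *m A d)
  - \sum_e torsion_coef e d c *: A e.

Hypothesis twistor1 : forall c,
  dpsi c + spin_conn w (A c) *m psi = - (n%:R^-1 *:: (g c *m phi)).
Hypothesis twistor2 : forall d c,
  ddpsi d c + (spin_conn w (dA d c) *m psi + spin_conn w (A c) *m dpsi d) =
  - (n%:R^-1 *:: (g c *m dphi d)).
Hypothesis bracket_psi : forall d c,
  ddpsi d c - ddpsi c d = \sum_e torsion_coef e d c *:: dpsi e.

(** [twistor2] is the derivative of [twistor1] along E_d.  Its skew part in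
    (d, c) involves the commutator of second derivatives of psi, that is
    [bracket_psi]; the first derivatives of psi are eliminated by [twistor1], and
    Clifford multiplication is parallel by [spin_conn_gam]. *)
Lemma twistor_integrability d c :
  spin_conn w (curvature d c) *m psi =
  - (n%:R^-1 *:: (g c *m (dphi d + spin_conn (w - 1) (A d) *m phi)
                - g d *m (dphi c + spin_conn (w - 1) (A c) *m phi))).
Proof.
move: twistor1 twistor2 (spin_connD w) (spin_connN w) (spin_connZ w)
  (@spin_connC w) (spin_conn_sum w) (@spin_conn_gam w).
move: (spin_conn w) (spin_conn (w - 1)) => G G' tw1 tw2 GD GN GZ GC Gsum Ggam.
have t1 e : dpsi e = - (n%:R^-1 *:: (g e *m phi)) - G (A e) *m psi.
  by rewrite -tw1 addrK.
have t2 a b : G (dA a b) *m psi = - (n%:R^-1 *:: (g b *m dphi a))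
   - ddpsi a b - G (A b) *m dpsi a.
  by rewrite -tw2 [_ + (_ + _)]addrC addrK addrK.
have sw a b : G (A a) *m (g b *m phi) =
    g b *m (G' (A a) *m phi) + cvec cl (fun e => A a e b) *m phi.
  by rewrite mulmxA Ggam // mulmxDl mulmxA.
rewrite /curvature 3!GD !GN GC // Gsum !mulmxDl !mulNmx.
have -> : (\sum_e G (torsion_coef e d c *: A e)) *m psi =
    (- n%:R^-1) *:: (cvec cl (fun e => A d e c) *m phi -
                     cvec cl (fun e => A c e d) *m phi)
    - (ddpsi d c - ddpsi c d).
  rewrite bracket_psi -mulmxBl /cvec -sumrB [in RHS]mulmx_suml scaler_sumr -sumrB.
  rewrite mulmx_suml.
  apply: eq_bigr => e _; rewrite t1 GZ -scalerBl -rmorphB -/(torsion_coef e d c).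
  rewrite -!scalemxAl.
  move: (g e *m phi) (G (A e) *m psi) (torsion_coef _ _ _) (n%:R^-1) => X Y s t.
  by mx_ring.
rewrite !t2 [dpsi d]t1 [dpsi c]t1 !mulmxBr !mulmxN -!scalemxAr !sw !mulmxDr.
rewrite -!mulmxA.
move: (g c *m dphi d) (g d *m dphi c) (g c *m (_ *m phi)) (g d *m (_ *m phi))
  (cvec _ _ *m phi) (cvec _ _ *m phi) (ddpsi d c) (ddpsi c d)
  (G (A d) *m (_ *m psi)) (G (A c) *m (_ *m psi)) n%:R^-1.
clear; move=> X1 X2 X3 X4 X5 X6 X7 X8 X9 Y1 t; mx_ring.
Qed.
End Integrability.

Section RealInnerProduct.
Variable ip : 'cV[R[i]]_N -> 'cV[R[i]]_N -> R.
Hypothesis ipC : forall u v, ip u v = ip v u.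
Hypothesis ipDl : forall u u' v, ip (u + u') v = ip u v + ip u' v.
Hypothesis ipZl : forall t u v, ip (t *:: u) v = t * ip u v.
Hypothesis ip_gam : forall a u v, ip (g a *m u) v = - ip u (g a *m v).

Lemma ipDr u v v' : ip u (v + v') = ip u v + ip u v'.
Proof. by rewrite ipC ipDl !(ipC u). Qed.

Lemma ipZr t u v : ip u (t *:: v) = t * ip u v.
Proof. by rewrite ipC ipZl (ipC u). Qed.

Lemma ipNl u v : ip (- u) v = - ip u v.
Proof. by rewrite -scaleN1r -(rmorphN1 (real_complex R)) ipZl mulN1r. Qed.

Lemma ipNr u v : ip u (- v) = - ip u v.
Proof. by rewrite ipC ipNl ipC. Qed.

Lemma ip0l v : ip 0 v = 0.
Proof. by have := ipDl 0 0 v; rewrite addr0; lra. Qed.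

Lemma ip_suml (P : pred 'I_n) (F : 'I_n -> 'cV[R[i]]_N) v :
  ip (\sum_(a | P a) F a) v = \sum_(a | P a) ip (F a) v.
Proof. by apply: (big_morph (ip ^~ v)) => [u u'|]; rewrite ?ipDl ?ip0l. Qed.

Lemma ip_sumr (P : pred 'I_n) (F : 'I_n -> 'cV[R[i]]_N) u :
  ip u (\sum_(a | P a) F a) = \sum_(a | P a) ip u (F a).
Proof. by rewrite ipC ip_suml; apply: eq_bigr => a _; exact: ipC. Qed.

Lemma ip_cvec f u v :
  ip u (cvec cl f *m v) = \sum_a f a * ip u (g a *m v).
Proof.
rewrite /cvec mulmx_suml ip_sumr; apply: eq_bigr => a _ /=.
by rewrite -scalemxAl ipZr.
Qed.

Lemma ip_cvec_skew f u v : ip (cvec cl f *m u) v = - ip u (cvec cl f *m v).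
Proof.
rewrite ip_cvec ipC ip_cvec -sumrN; apply: eq_bigr => a _ /=.
by rewrite (ipC v) ip_gam mulrN.
Qed.

Lemma ip_cvec_self f u : ip (cvec cl f *m u) u = 0.
Proof. by have := ip_cvec_skew f u u; rewrite (ipC u); lra. Qed.

(** The e_a . u are orthogonal and as long as [u]: the symmetric part of
    e_a . e_b is a multiple of the identity. *)
Lemma ip_gam_gam a b u : ip (g a *m u) (g b *m u) = ip u u * (a == b)%:R.
Proof.
have e := ipC (g a *m u) (g b *m u); rewrite !ip_gam in e.
have : ip u (g a *m (g b *m u)) =
    - ip u (g b *m (g a *m u)) - 2 * (a == b)%:R * ip u u.
  rewrite mulmxA (gam_anticomm cl a b) mulmxBl mulNmx -scalemxAl mul1mx.
  by rewrite ipDr !ipNr ipZr -mulmxA.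
rewrite ip_gam; lra.
Qed.

Lemma ip_spin_lift A u v : ip (sg A *m u) v = - ip u (sg A *m v).
Proof.
have -> : sg A = 4^-1 *::
    \sum_a \sum_(b | b != a) (A b a)%:C *: (g a *m g b).
  by rewrite /spin_lift fmorphV rmorph_nat.
rewrite -!scalemxAl ipZl ipZr -mulrN; congr (_ * _).
rewrite !mulmx_suml ip_suml ip_sumr -sumrN; apply: eq_bigr => a _.
rewrite !mulmx_suml ip_suml ip_sumr -sumrN; apply: eq_bigr => b ba.
rewrite -!scalemxAl ipZl ipZr -mulrN; congr (_ * _).
rewrite -!mulmxA !ip_gam opprK [in LHS]mulmxA (gam_anticomm cl b a).
rewrite (negPf ba) mulr0 scale0r subr0.
by rewrite mulNmx ipNr mulmxA.
Qed.

(** The connection is metric up to the weight. *)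
Lemma ip_spin_conn w w' A u v :
  ip (spin_conn w A *m u) v + ip u (spin_conn w' A *m v) =
  (w + w') * co_trace A * ip u v.
Proof.
rewrite /spin_conn !mulmxDl !mul_scalar_mx ipDl ipDr ipZl ipZr ip_spin_lift.
ring.
Qed.

Section Parallel.
Variables (w : R) (A : 'M[R]_n) (psi phi dpsi dphi : 'cV[R[i]]_N).
Variables (xi eta : 'I_n -> R).
Hypothesis cA : co A.
Hypothesis dpsiE :
  dpsi = - (n%:R^-1 *:: (cvec cl xi *m phi)) - spin_conn w A *m psi.
Hypothesis dphiE : dphi = cvec cl eta *m psi - spin_conn (w - 1) A *m phi.
Local Notation tau := (co_trace A).

(** Up to the connection terms, which the weight absorbs, the derivative of each
    factor is a real Clifford multiple of the other factor. *)
Lemma parallel_C :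
  ip dpsi phi + ip psi dphi + (2 * w - 1) * tau * ip psi phi = 0.
Proof.
have := ip_spin_conn w (w - 1) A psi phi.
rewrite dpsiE dphiE ipDl ipDr !ipNl ipNr ipZl ip_cvec_self.
rewrite (ipC psi (cvec _ _ *m _)) ip_cvec_self; lra.
Qed.

Let p i := ip phi (g i *m psi).
Let dp i := ip dphi (g i *m psi) + ip phi (g i *m dpsi).

Lemma d_normsq_psi : ip dpsi psi + ip psi dpsi =
  2 / n%:R * \sum_i xi i * p i - 2 * w * tau * ip psi psi.
Proof.
have e := ip_spin_conn w w A psi psi; rewrite (ipC psi (_ *m _)) in e.
have e' := ip_cvec xi phi psi; rewrite -/p in e'.
rewrite (ipC psi) dpsiE ipDl !ipNl ipZl ip_cvec_skew e'.
by move: e; move: (\sum_i _) => s e; lra.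
Qed.

Lemma d_normsq_phi : ip dphi phi + ip phi dphi =
  2 * \sum_i eta i * p i - 2 * (w - 1) * tau * ip phi phi.
Proof.
have e := ip_spin_conn (w - 1) (w - 1) A phi phi; rewrite (ipC (_ *m _)) in e.
have e' := ip_cvec eta phi psi; rewrite -/p in e'.
rewrite (ipC dphi) dphiE ipDr ipNr e'.
by move: e; move: (\sum_i _) => s e; lra.
Qed.

(** The last sum is the rotation of the frame.  It contributes nothing to the sum of
    squares except through the trace of [A]. *)
Lemma d_pairing i : dp i = eta i * ip psi psi + xi i * ip phi phi / n%:R
  - 2 * w * tau * p i + \sum_e A e i * p e.
Proof.
have e1 : ip (cvec cl eta *m psi) (g i *m psi) = eta i * ip psi psi.
  rewrite ipC ip_cvec -[RHS](sum_delta (fun a => eta a * ip psi psi) i).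
  by apply: eq_bigr => a _; rewrite ip_gam_gam mulrA.
have e2 : ip phi (g i *m (cvec cl xi *m phi)) = - (xi i * ip phi phi).
  rewrite -[LHS]opprK -ip_gam ip_cvec; congr (- _).
  rewrite -[RHS](sum_delta (fun a => xi a * ip phi phi) i).
  by apply: eq_bigr => a _; rewrite ip_gam_gam mulrA.
have e3 : g i *m (spin_conn w A *m psi) =
    spin_conn (w + 1) A *m (g i *m psi) - cvec cl (fun a => A a i) *m psi.
  have := @spin_conn_gam (w + 1) A i cA; rewrite addrK => sc.
  by rewrite [in RHS]mulmxA sc mulmxDl addrK mulmxA.
have e4 := ip_spin_conn (w - 1) (w + 1) A phi (g i *m psi).
have e5 := ip_cvec (fun a => A a i) phi psi.
rewrite /dp dphiE dpsiE mulmxBr mulmxN -scalemxAr e3.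
rewrite ipDl ipNl !ipDr !ipNr !ipDr !ipNr ipZr e1 e2 e5 -/p -/(p i).
move: e4; rewrite -/(p i); move: (\sum_i _) => s e4; lra.
Qed.

(** The sums over xi and over eta in the derivative of the sum of squares are those
    in the derivative of the product of the squared norms. *)
Lemma parallel_Q :
  (ip dpsi psi + ip psi dpsi) * ip phi phi +
  ip psi psi * (ip dphi phi + ip phi dphi) -
  \sum_i 2 * (p i * dp i) +
  (4 * w - 2) * tau * (ip psi psi * ip phi phi - \sum_i p i ^+ 2) = 0.
Proof.
have -> : \sum_i 2 * (p i * dp i) = 2 * ip psi psi * (\sum_i eta i * p i) +
    2 * (ip phi phi / n%:R) * (\sum_i xi i * p i) +
    - (4 * w * tau) * (\sum_i p i ^+ 2) +
    2 * (\sum_i p i * (\sum_e A e i * p e)).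
  rewrite !mulr_sumr -!big_split /=; apply: eq_bigr => i _.
  rewrite d_pairing; move: (\sum_e _) => s; ring.
have -> : \sum_i p i * (\sum_e A e i * p e) = tau * \sum_i p i ^+ 2.
  have s1 : \sum_i p i * (\sum_e A e i * p e) = \sum_i \sum_e p i * p e * A e i.
    by apply: eq_bigr => i _; rewrite mulr_sumr; apply: eq_bigr => e _; ring.
  have s2 : \sum_i p i * (\sum_e A e i * p e) = \sum_i \sum_e p i * p e * A i e.
    rewrite s1 exchange_big; apply: eq_bigr => i _; apply: eq_bigr => e _.
    by rewrite [p e * _]mulrC.
  have : 2 * (\sum_i p i * (\sum_e A e i * p e)) = 2 * (tau * \sum_i p i ^+ 2).
    rewrite mulr_natl mulr2n {1}s1 s2 -big_split !mulr_sumr.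
    apply: eq_bigr => i _ /=; rewrite -big_split /=.
    rewrite expr2 -[RHS](sum_delta (fun e => 2 * (tau * (p i * p e))) i).
    by apply: eq_bigr => e _; rewrite -mulrDr addrC (co_traceP cA); ring.
  by move=> /mulfI; apply; rewrite pnatr_eq0.
rewrite d_normsq_psi d_normsq_phi.
move: (\sum_i _) (\sum_i _) (\sum_i _) => s t r; ring.
Qed.
End Parallel.
End RealInnerProduct.

Lemma Re_hprod_cvec f u v : complex.Re (h u (cvec cl f *m v)) =
  \sum_a f a * complex.Re (h u (g a *m v)).
Proof.
rewrite /cvec mulmx_suml hprod_sumr raddf_sum; apply: eq_bigr => a _ /=.
by rewrite -scalemxAl hprodZr conjc_real ReZ.
Qed.

(** Conjugation by an element of Spin(n) turns the frame by the orthogonal matrix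
    below it, and a sum of squares of frame components is invariant. *)
Lemma pairing_Spin_invariant S u v : Spin cl S ->
  \sum_i complex.Re (h (invmx S *m u) (g i *m (invmx S *m v))) ^+ 2 =
  \sum_i complex.Re (h u (g i *m v)) ^+ 2.
Proof.
move=> sS; have [A [lA oA]] := Spin_lambda sS.
have [uS _] := Spin_unitary sS.
pose q k := complex.Re (h u (g k *m v)).
have e i : complex.Re (h (invmx S *m u) (g i *m (invmx S *m v))) =
    \sum_k A k i * q k.
  have -> : g i *m (invmx S *m v) =
      invmx S *m (cvec cl (fun k => A k i) *m v).
    have := lA (delta_mx i ord0); rewrite clif_delta => l1.
    have -> : cvec cl (fun k => A k i) = clif cl (A *m delta_mx i ord0).
      by rewrite -colE; apply: eq_bigr => k _; rewrite mxE.
    rewrite -[LHS](mulKmx uS); congr (_ *m _).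
    by rewrite [LHS]mulmxA l1 -mulmxA mulKVmx.
  by rewrite hprod_Spin_inv // Re_hprod_cvec.
transitivity (\sum_i (\sum_k A k i * q k) ^+ 2).
  by apply: eq_bigr => i _; rewrite e.
rewrite -[RHS]/(\sum_k q k ^+ 2); clearbody q; clear e lA.
under eq_bigr => i _ do rewrite expr2 mulr_suml.
rewrite exchange_big; apply: eq_bigr => k _ /=.
under eq_bigr => i _ do rewrite mulr_sumr.
rewrite exchange_big /= expr2 -[RHS](sum_delta (fun l => q k * q l) k).
apply: eq_bigr => l _; have /matrixP /(_ k l) := oA; rewrite !mxE => <-.
by rewrite mulr_sumr; apply: eq_bigr => i _; rewrite mxE; ring.
Qed.
End SpinConnection.

(** * Curvature of a connection in a moving frame *)

Section BianchiAlgebra.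
Variables (R : realType) (n : nat).
Variables (A : 'I_n -> 'M[R]_n) (dA : 'I_n -> 'I_n -> 'M[R]_n).
Variables (f : 'I_n -> R) (hh : 'I_n -> 'I_n -> R) (t : 'I_n -> 'I_n -> 'I_n -> R).
Local Notation T := (torsion_coef A).
Hypothesis hess : forall d c, hh d c - hh c d = \sum_e T e d c * f e.
Hypothesis third_r : forall b d c, t b d c - t b c d =
  \sum_e ((dA b d e c - dA b c e d) * f e + T e d c * hh b e).
Hypothesis third_l : forall b d c, t b d c - t d b c = \sum_e T e b d * hh e c.

(** The algebra behind the Bianchi identity, for the first, second and third
    derivatives [f], [hh], [t] of a function along the frame.  [hess] and [third_l]
    are commutators of frame fields, [third_r] is the derivative of [hess].
    The six ways of exchanging two of the three derivatives close up into a
    hexagon, so the sum of the corresponding commutators is zero; the second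
    derivatives cancel from it by [hess]. *)
Lemma bianchi_algebra b d c :
  \sum_e (curvature A dA b d e c + curvature A dA d c e b
          + curvature A dA c b e d) * f e = 0.
Proof.
pose X b d c := \sum_e dA b d e c * f e.
pose P b d c := \sum_e (A b *m A d) e c * f e.
pose r b d c := \sum_a (\sum_e A b e d * A e a c) * f a.
pose u b d c := \sum_e A b e d * hh e c.
pose v b d c := \sum_e A b e d * hh c e.
(* Exchanging the two derivatives in a product of A and [hh] costs [hess]
   contracted with A, that is first derivatives only. *)
have uv i j k : u i j k - v i j k = r i j k - P k i j.
  rewrite /u /v /r /P -sumrB.
  transitivity (\sum_e \sum_a (A i e j * A e a k - A k a e * A i e j) * f a).
    apply: eq_bigr => e _; rewrite -mulrBr hess mulr_sumr; apply: eq_bigr => a _.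
    rewrite /torsion_coef; ring.
  rewrite exchange_big -sumrB; apply: eq_bigr => a _ /=.
  by rewrite mxE -mulrBl -sumrB mulr_suml.
have H2 i j k : t i j k - t i k j = X i j k - X i k j + (v j k i - v k j i).
  rewrite third_r /X /v -!sumrB -big_split; apply: eq_bigr => e _ /=.
  rewrite /torsion_coef; ring.
have H3 i j k : t i j k - t j i k = u i j k - u j i k.
  rewrite third_l /u -sumrB; apply: eq_bigr => e _.
  rewrite /torsion_coef; ring.
have C i j k : \sum_e curvature A dA i j e k * f e =
    X i j k - X j i k + (P i j k - P j i k) - (r i j k - r j i k).
  rewrite /X /P /r -!sumrB -big_split -sumrB; apply: eq_bigr => e _ /=.
  have -> : curvature A dA i j e k = dA i j e k - dA j i e k +
      ((A i *m A j) e k - (A j *m A i) e k) - (\sum_a torsion_coef A a i j * A a e k).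
    rewrite /curvature; do ?[rewrite mxD | rewrite mxN]; rewrite summxE.
    by congr (_ - _); apply: eq_bigr => a _; rewrite mxZ.
  have -> : \sum_a torsion_coef A a i j * A a e k =
      \sum_a A i a j * A a e k - \sum_a A j a i * A a e k.
    by rewrite -sumrB; apply: eq_bigr => a _; rewrite /torsion_coef mulrBl.
  ring.
have -> : \sum_e (curvature A dA b d e c + curvature A dA d c e b
          + curvature A dA c b e d) * f e =
    \sum_e curvature A dA b d e c * f e + \sum_e curvature A dA d c e b * f e
    + \sum_e curvature A dA c b e d * f e.
  by rewrite -!big_split; apply: eq_bigr => e _ /=; ring.
rewrite !C.
have := H3 b d c; have := H3 d c b; have := H3 c b d.
have := H2 d b c; have := H2 c d b; have := H2 b c d.
have := uv b d c; have := uv d c b; have := uv c b d.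
have := uv d b c; have := uv c d b; have := uv b c d.
lra.
Qed.
End BianchiAlgebra.

Section CurvatureSymmetries.
Variables (R : realType) (n : nat).
Variables (A : 'I_n -> 'M[R]_n) (dA : 'I_n -> 'I_n -> 'M[R]_n).
Hypothesis cA : forall a, co (A a).
Hypothesis cdA : forall a b, co (dA a b).

Lemma curvature_skew d c : curvature A dA c d = - curvature A dA d c.
Proof.
have -> : curvature A dA c d = dA c d - dA d c + (A c *m A d - A d *m A c)
    + \sum_e torsion_coef A e d c *: A e.
  rewrite /curvature -sumrN; congr (_ + _); apply: eq_bigr => e _.
  by rewrite -scaleNr; congr (_ *: _); rewrite /torsion_coef opprB.
rewrite /curvature; move: (\sum_e _) (A c *m A d) (A d *m A c) => S X Y.
by mx_ring.
Qed.

Lemma co_curvature d c : co (curvature A dA d c).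
Proof.
rewrite /curvature; apply: coD; first apply: coD.
- by apply: coD => //; exact: coN.
- exact: coC.
- by apply: coN; apply: co_sum => e; exact: coZ.
Qed.

Lemma co_trace_curvature d c : co_trace (curvature A dA d c) =
  co_trace (dA d c) - co_trace (dA c d)
  - \sum_e torsion_coef A e d c * co_trace (A e).
Proof.
rewrite /curvature !co_traceD !co_traceN.
have -> : co_trace (\sum_e torsion_coef A e d c *: A e) =
    \sum_e torsion_coef A e d c * co_trace (A e).
  rewrite (big_morph _ (@co_traceD R n) (@co_trace0 R n)).
  by apply: eq_bigr => e _; rewrite co_traceZ.
have := co_trace_commutator (A d) (A c); rewrite co_traceD co_traceN.
lra.
Qed.
End CurvatureSymmetries.

Section RealMatrixDerivative.
Variables (R : realType) (n : nat) (M : smooth_manifold R n).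
Variables (x : M) (v : tvec M).
Hypothesis tv : tangent x v.
Variables (cl : clifford_module R n).
Local Notation N := (spin_dim n).
Local Notation "x *:: X" := (x%:C *: X) (at level 40).

Lemma smooth_co_trace (A : M -> 'M[R]_n) y : smooth_mx A y ->
  smooth_at (fun z => co_trace (A z)) y.
Proof.
move=> sA; rewrite /co_trace /mxtrace.
under eq_fun do rewrite mulrC.
apply: (@smooth_atZ _ _ _ (n%:R^-1) (fun z => \sum_i A z i i)).
by apply: smooth_at_sum => i _; exact: sA.
Qed.

Lemma d_co_trace (A : M -> 'M[R]_n) : smooth_mx A x ->
  v (fun z => co_trace (A z)) = co_trace (d_mx v A).
Proof.
move=> sA; rewrite /co_trace /mxtrace.
under eq_fun do rewrite mulrC.
rewrite (tangentZ tv) ?(tangent_sum tv) // 1?mulrC; last first.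
  by apply: smooth_at_sum => i _; exact: sA.
by congr (_ * _); apply: eq_bigr => i _; rewrite mxE.
Qed.

(** The defining relation of co(n) is linear, so it may be differentiated. *)
Lemma co_d_mx (A : M -> 'M[R]_n) : smooth_mx A x ->
  (\near x, co (A x)) -> co (d_mx v A).
Proof.
move=> sA cA; exists (2 * v (fun z => co_trace (A z))).
apply/matrixP=> i j; rewrite !mxE -(tangentD tv) //.
have e : \forall y \near x, 2 * (i == j)%:R * co_trace (A y) = A y i j + A y j i.
  by apply: filterS cA => y /co_traceP ->; rewrite mulrAC.
rewrite -(tangent_ext tv e); last by apply: smooth_atZ; exact: smooth_co_trace.
rewrite (tangentZ tv) //; last exact: smooth_co_trace.
by rewrite -[RHS]mulr_natr mulrAC.
Qed.

Lemma smooth_spin_lift (A : M -> 'M[R]_n) y : smooth_mx A y ->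
  smooth_cmx (fun z => spin_lift cl (A z)) y.
Proof.
move=> sA; rewrite /spin_lift.
have -> : (4^-1 : R[i]) = (4^-1)%:C by rewrite fmorphV rmorph_nat.
apply: smooth_cmxZ; first exact: smooth_at_cst.
apply: smooth_cmx_sum => a _; apply: smooth_cmx_sum => b _.
by apply: smooth_cmxZ; [exact: sA|exact: smooth_cmx_cst].
Qed.

Lemma d_spin_lift (A : M -> 'M[R]_n) : smooth_mx A x ->
  d_cmx v (fun z => spin_lift cl (A z)) = spin_lift cl (d_mx v A).
Proof.
move=> sA; rewrite /spin_lift.
have -> : (4^-1 : R[i]) = (4^-1)%:C by rewrite fmorphV rmorph_nat.
have s2 a b : smooth_cmx (fun z => (A z b a)%:C *: (gam cl a *m gam cl b)) x.
  by apply: smooth_cmxZ; [exact: sA|exact: smooth_cmx_cst].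
have s1 a : smooth_cmx
    (fun z => \sum_(b | b != a) (A z b a)%:C *: (gam cl a *m gam cl b)) x.
  by apply: smooth_cmx_sum => b _.
rewrite (d_cmxZ tv (smooth_at_cst _ x)); last by apply: smooth_cmx_sum => a _.
rewrite (tangent_cst tv) scale0r add0r (d_cmx_sum tv) //; congr (_ *: _).
apply: eq_bigr => a _; rewrite (d_cmx_sum tv) //; apply: eq_bigr => b _.
rewrite (d_cmxZ tv (sA _ _) (smooth_cmx_cst _ _)) (d_cmx_cst tv) scaler0 addr0.
by rewrite mxE.
Qed.

Lemma smooth_spin_conn w (A : M -> 'M[R]_n) y : smooth_mx A y ->
  smooth_cmx (fun z => spin_conn cl w (A z)) y.
Proof.
move=> sA; rewrite /spin_conn.
under eq_fun do rewrite -scalemx1.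
apply: smooth_cmxD; last exact: smooth_spin_lift.
apply: smooth_cmxZ; last exact: smooth_cmx_cst.
by apply: smooth_atZ; exact: smooth_co_trace.
Qed.

Lemma d_spin_conn w (A : M -> 'M[R]_n) : smooth_mx A x ->
  d_cmx v (fun z => spin_conn cl w (A z)) = spin_conn cl w (d_mx v A).
Proof.
move=> sA; rewrite /spin_conn.
under eq_fun do rewrite -scalemx1.
have st := smooth_co_trace sA; have swt := smooth_atZ w st.
have s1 := smooth_cmxZ swt (smooth_cmx_cst (1%:M : 'M[R[i]]_N) x).
rewrite (d_cmxD tv s1 (smooth_spin_lift sA)) d_spin_lift //; congr (_ + _).
rewrite (d_cmxZ tv swt (smooth_cmx_cst _ x)) (d_cmx_cst tv) scaler0 addr0.
by rewrite (tangentZ tv w st) d_co_trace // scalemx1.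
Qed.
End RealMatrixDerivative.

(** * Weyl structures in a local section *)

Section LocalSection.
Variables (R : realType) (n : nat) (M : smooth_manifold R n).
Variables (o : M -> frame M -> Prop) (ho : orientation o).
Variables (c : set (form2 M)) (cl : clifford_module R n).
Variables (Q : cspin_structure cl o c) (W : weyl_structure o c).
Variables (U : set M) (s : M -> Q).
Hypothesis hs : local_section U s.

Definition section_frame (y : M) : frame M := fr (s y).
Local Notation p := section_frame.
Definition section_vf (a : 'I_n) : vfield M := fun y => p y a.
Local Notation E := section_vf.
Definition conn_mx (a : 'I_n) (y : M) : 'M[R]_n := W p y (E a y).
Local Notation A := conn_mx.

Lemma section_open : open U. Proof. exact: hs.1. Qed.

Lemma proj_section y : U y -> Defs.proj (s y) = y.
Proof. by move=> /(hs.2) []. Qed.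

Lemma smooth_section_frame : smooth_frame U p.
Proof. exact: (fr_smooth hs). Qed.

Lemma conformal_section_frame y : U y -> conformal_frame o c y (p y).
Proof. by move=> Uy; have := fr_conformal (s y); rewrite proj_section. Qed.

Lemma section_frameP y : U y -> is_frame y (p y).
Proof.
by move=> /conformal_section_frame [oy _]; exact: orientation_frame ho _ _ oy.
Qed.

Lemma tangent_section_vf y a : U y -> tangent y (E a y).
Proof. by move=> /section_frameP [te _]; exact: te. Qed.

Lemma near_section x (P : M -> Prop) : U x -> (forall y, U y -> P y) ->
  \forall y \near x, P y.
Proof.
move=> Ux UP; near=> y; apply: UP; near: y.
by apply: open_nbhs_nbhs; split=> //; exact: section_open.
Unshelve. all: by end_near. Qed.

(** Smoothness at [y] of a derivative along a frame field, the step that is repeated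
    to form second and third derivatives. *)
Lemma smooth_vf a y f : U y -> smooth_at f y -> smooth_at (fun z => E a z f) y.
Proof. by move=> Uy sf; exact: ((smooth_section_frame a Uy).2 f sf). Qed.

Lemma conn_linear y i j : U y -> forall (t : R) u v, tangent y u -> tangent y v ->
  W p y (fun f => t * u f + v f) i j = t * W p y u i j + W p y v i j.
Proof.
move=> Uy t u v tu tv.
by have [+ _] := conn_form W section_open smooth_section_frame
  (@conformal_section_frame) i j; apply.
Qed.

Lemma conn_vec y xi : U y -> W p y (vec (p y) xi) = \sum_a xi a ord0 *: A a y.
Proof.
move=> Uy; apply/matrixP=> i j; rewrite summxE.
have te a : tangent y (p y a) by exact: tangent_section_vf.
rewrite (linear_form_vec te xi (conn_linear i j Uy)).
by apply: eq_bigr => a _; rewrite mxE.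
Qed.

Lemma smooth_conn_mx a y : U y -> smooth_mx (A a) y.
Proof.
move=> Uy i j.
have [_ sm] := conn_form W section_open smooth_section_frame
  (@conformal_section_frame) i j.
exact: (sm U (E a) section_open (@subset_refl _ U) (smooth_section_frame a) y Uy).
Qed.

Lemma co_conn v y : U y -> tangent y v -> co (W p y v).
Proof.
by apply: (conn_co W section_open smooth_section_frame) => z;
  exact: conformal_section_frame.
Qed.

Lemma co_conn_mx a y : U y -> co (A a y).
Proof. by move=> Uy; apply: co_conn => //; exact: tangent_section_vf. Qed.

Local Notation T y := (torsion_coef (fun a => A a y)).

(** The only use of the absence of torsion. *)
Lemma bracket_vec y d e : U y ->
  bracket (E d) (E e) y = vec (p y) (\col_a T y a d e).
Proof.
move=> Uy; have := conn_torsion_free W section_open smooth_section_frame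
  (@conformal_section_frame) d e Uy => ->.
apply/funext=> f; rewrite /vec -sumrB; apply: eq_bigr => a _.
by rewrite !mxE /torsion_coef mulrBl.
Qed.

Lemma vf_commutator y d e f : U y -> smooth_at f y ->
  E d y (fun z => E e z f) - E e y (fun z => E d z f) =
  \sum_a T y a d e * E a y f.
Proof.
move=> Uy sf; have := bracket_vec d e Uy => /(congr1 (fun v => v f)).
rewrite /bracket asboolT // => ->.
by apply: eq_bigr => a _; rewrite mxE.
Qed.

Lemma smooth_torsion y a d e : U y -> smooth_at (fun z => T z a d e) y.
Proof. by move=> Uy; apply: smooth_atB; exact: smooth_conn_mx. Qed.

Definition dconn_mx x d a : 'M[R]_n := d_mx (E d x) (A a).
Definition section_curv x d e : 'M[R]_n :=
  curvature (fun a => A a x) (dconn_mx x) d e.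

Lemma co_dconn_mx x d a : U x -> co (dconn_mx x d a).
Proof.
move=> Ux; apply: (co_d_mx (tangent_section_vf d Ux)); first exact: smooth_conn_mx.
by apply: near_section => // y; exact: co_conn_mx.
Qed.

(** Tested on the coordinates of a chart at [x]: these are smooth near [x], so that
    the commutator identity may be differentiated there, and they separate the
    frame vectors. *)
Lemma first_bianchi x d e b a : U x ->
  section_curv x d e a b + section_curv x e b a d + section_curv x b d a e = 0.
Proof.
move=> Ux; have [i ix] := chart_cover x.
pose Z : 'cV[R]_n := \col_a
  (section_curv x d e a b + section_curv x e b a d + section_curv x b d a e).
suff : Z = 0 by move/matrixP => /(_ a ord0); rewrite !mxE.
apply: (coord_separate ix (section_frameP Ux)) => k.
pose chi : M -> R := coord i k.
have oV : open (U `&` chart_dom i).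
  by apply: openI; [exact: section_open|exact: chart_dom_open].
have schi y : chart_dom i y -> smooth_at chi y by exact: smooth_coord.
pose f a y := E a y chi.
have sf a' y : U y -> chart_dom i y -> smooth_at (f a') y.
  by move=> Uy iy; apply: smooth_vf => //; exact: schi.
have := @bianchi_algebra R n (fun a => A a x) (dconn_mx x)
  (fun a => f a x) (fun d e => E d x (f e))
  (fun b d e => E b x (fun y => E d y (f e))) _ _ _ d e b.
rewrite /vec => H; rewrite -[RHS]H.
- apply: eq_bigr => a' _; rewrite mxE; congr (_ * _).
- by move=> d' e'; rewrite vf_commutator //; exact: schi.
- move=> b' d' e'; have tb := tangent_section_vf b' Ux.
  (* The commutator identity holds in a neighbourhood, as required for taking its
     derivative. *)
  have near_hess : \forall y \near x, E d' y (f e') - E e' y (f d') =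
      \sum_a T y a d' e' * f a y.
    near=> y; have [Uy iy] : (U `&` chart_dom i) y.
      by near: y; apply: open_nbhs_nbhs.
    by rewrite vf_commutator //; exact: schi.
  have sdf d1 e1 : smooth_at (fun y => E d1 y (f e1)) x.
    by apply: smooth_vf => //; exact: sf.
  rewrite -(tangentB tb) //.
  rewrite (tangent_ext tb near_hess); last exact: smooth_atB.
  rewrite (tangent_sum tb) => [|a' _]; last first.
    by apply: smooth_atM; [exact: smooth_torsion|exact: sf].
  apply: eq_bigr => a' _.
  rewrite (tangentM tb); [|exact: smooth_torsion|exact: sf].
  congr (_ * _ + _); rewrite /dconn_mx !mxE.
  by rewrite -(tangentB tb) //; exact: smooth_conn_mx.
- by move=> b' d' e'; rewrite vf_commutator //; exact: sf.
Unshelve. all: by end_near. Qed.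

Section Faraday.
Hypothesis hn : (0 < n)%N.
Hypothesis hc : conformal_class c.
Variables (g : form2 M) (theta : form1 M) (F : form2 M).
Hypotheses (cg : c g) (lee : is_lee_form Q W g theta) (ext : is_ext_deriv theta F).

Lemma bilinear_g : bilinear_section g.
Proof. by move: cg; have [g0 _ ->] := hc; case=> -[]. Qed.

(** The frame is conformal for some metric of the class, and any two metrics of the
    class are proportional. *)
Lemma metric_on_frame y : U y -> exists2 r, 0 < r &
  forall a b, g y (E a y) (E b y) = r * (a == b)%:R.
Proof.
move=> Uy; have [_ [g' cg' [r r0 g'E]]] := conformal_section_frame Uy.
move: cg cg'; have [g0 _ ->] := hc.
move=> [_ [u [u0 gE]]] [_ [u' [u'0 g'E']]].
have [uy _] := u0 y; have [u'y _] := u'0 y.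
exists (u y * (r / u' y)); first by rewrite !mulr_gt0 ?invr_gt0.
move=> a b; have ta := tangent_section_vf a Uy; have tb := tangent_section_vf b Uy.
rewrite gE // -mulrA; congr (_ * _).
have := g'E' y _ _ ta tb; rewrite -/(E a y) [LHS](g'E a b) => e.
by apply: (mulfI (lt0r_neq0 u'y)); rewrite -e; field; rewrite gt_eqF.
Qed.

Let a0 : 'I_n := Ordinal hn.
Definition metric_scale y := g y (E a0 y) (E a0 y).
Local Notation r := metric_scale.
(** The length density of [g] in the section: the frame is orthogonal with common
    squared length [r], so its volume is r^(n/2). *)
Definition metric_length y := r y `^ (- 2^-1).
Local Notation rho := metric_length.

Lemma metric_scale_gt0 y : U y -> 0 < r y.
Proof.
by move=> /metric_on_frame [t t0 gE]; rewrite /r gE eqxx mulr1.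
Qed.

Lemma smooth_metric_scale y : U y -> smooth_at r y.
Proof.
move=> Uy; have [_ sm] := bilinear_g.
exact: (sm U _ _ section_open (smooth_section_frame a0) (smooth_section_frame a0) y Uy).
Qed.

Lemma smooth_metric_length y : U y -> smooth_at rho y.
Proof.
move=> Uy; apply: smooth_at_powRN2; [exact: metric_scale_gt0|exact: smooth_metric_scale].
Qed.

Lemma length_densityE y : U y -> length_density g (s y) = rho y.
Proof.
move=> Uy; rewrite /length_density proj_section // /rho.
have r0 := metric_scale_gt0 Uy.
have [t t0 gE] := metric_on_frame Uy.
have rt : r y = t by rewrite /r gE eqxx mulr1.
have -> : \matrix_(a, b) g y (fr (s y) a) (fr (s y) b) = (r y)%:M.
  by apply/matrixP=> a b; rewrite !mxE [LHS]gE rt mulr_natr.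
rewrite det_scalar -powR_mulrn ?ltW // -powR12_sqrt ?powR_ge0 // -powRrM.
rewrite ger0_norm ?powR_ge0 // -powRrM; congr (_ `^ _).
have n0 : n%:R != 0 :> R by rewrite pnatr_eq0 -lt0n.
by field; rewrite n0.
Qed.

Definition metric_inv_length y := r y * rho y.
Local Notation m := metric_inv_length.

Lemma metric_lengthK y : U y -> rho y * m y = 1.
Proof.
move=> Uy; have r0 := metric_scale_gt0 Uy.
have r1 : r y != 0 by rewrite gt_eqF.
rewrite /m mulrCA -powRD; last by rewrite r1 implybT.
have -> : - 2^-1 - 2^-1 = -1 :> R by lra.
by rewrite powR_inv1 ?mulfV // ltW.
Qed.

Lemma smooth_metric_inv_length y : U y -> smooth_at m y.
Proof.
by move=> Uy; apply: smooth_atM; [exact: smooth_metric_scale|exact: smooth_metric_length].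
Qed.

(** The density is divided out of the defining equation of the Lee form by
    multiplying with its smooth inverse, so that the right-hand side can be
    differentiated. *)
Lemma lee_form y v : U y -> tangent y v ->
  theta y v = m y * v rho + co_trace (W p y v).
Proof.
move=> Uy tv; have := lee hs Uy tv; rewrite /nabla_density length_densityE // mul1r.
have -> : v (fun z => length_density g (s z)) = v rho.
  apply/esym; apply: (tangent_ext tv); last exact: smooth_metric_length.
  by apply: near_section => // z Uz; rewrite length_densityE.
move=> e; rewrite -[LHS]mulr1 -(metric_lengthK Uy) mulrA -e.
have := metric_lengthK Uy; rewrite mulrC.
move: (co_trace _) (v rho) => t w'; rewrite mulrDl => mr.
by rewrite mulrC -[t * _ * _]mulrA [rho y * _]mulrC mr mulr1.
Qed.

(** The logarithmic derivative is closed: its exterior derivative is the commutator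
    of second derivatives of [rho], corrected by the products of first derivatives
    coming from the inverse [m], which are symmetric. *)
Lemma faraday_curvature x d e : U x ->
  F x (E d x) (E e x) = co_trace (section_curv x d e).
Proof.
move=> Ux; have td := tangent_section_vf d Ux; have te := tangent_section_vf e Ux.
have -> : F x (E d x) (E e x) = E d x (fun y => theta y (E e y)) -
    E e x (fun y => theta y (E d y)) - theta x (bracket (E d) (E e) x).
  exact: (ext section_open (smooth_section_frame d) (smooth_section_frame e) Ux).
have sr := smooth_metric_length Ux; have sm := smooth_metric_inv_length Ux.
have stau a : smooth_at (fun y => co_trace (A a y)) x.
  by apply: smooth_co_trace; exact: smooth_conn_mx.
have svr a : smooth_at (fun y => E a y rho) x by exact: smooth_vf.
have dm v : tangent x v -> v m = - (m x ^+ 2 * v rho).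
  move=> tv; have : v (fun y => rho y * m y) = 0.
    rewrite -(tangent_cst tv 1); apply: (tangent_ext tv).
      by apply: near_section => // y; exact: metric_lengthK.
    exact: smooth_atM.
  rewrite (tangentM tv) // => e0.
  have mr := metric_lengthK Ux.
  have -> : v m = rho x * m x * v m by rewrite mr mul1r.
  have -> : rho x * m x * v m = m x * (v rho * m x + rho x * v m) -
     m x ^+ 2 * v rho by ring.
  by rewrite e0 mulr0 sub0r.
have dth v a : tangent x v -> v (fun y => theta y (E a y)) =
    - (m x ^+ 2 * v rho) * E a x rho + m x * v (fun y => E a y rho) +
    v (fun y => co_trace (A a y)).
  move=> tv; transitivity (v (fun y => m y * E a y rho + co_trace (A a y))).
    apply/esym; apply: (tangent_ext tv).
      apply: near_section => // y Uy; rewrite lee_form //.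
      exact: tangent_section_vf.
    by apply: smooth_atD => //; exact: smooth_atM.
  rewrite (tangentD tv) //; last exact: smooth_atM.
  by rewrite (tangentM tv) // (dm v tv).
have -> : theta x (bracket (E d) (E e) x) =
    m x * (E d x (fun y => E e y rho) - E e x (fun y => E d y rho)) +
    \sum_a T x a d e * co_trace (A a x).
  rewrite bracket_vec // lee_form //; last first.
    by apply: tangent_vec => a; exact: tangent_section_vf.
  rewrite vf_commutator //; congr (_ * _ + _).
    by apply: eq_bigr => a _; rewrite mxE.
  rewrite conn_vec // (big_morph _ (@co_traceD R n) (@co_trace0 R n)).
  by apply: eq_bigr => a _; rewrite co_traceZ mxE.
rewrite (dth _ e td) (dth _ d te) /section_curv co_trace_curvature /dconn_mx.
rewrite -(d_co_trace td (smooth_conn_mx e Ux)) -(d_co_trace te (smooth_conn_mx d Ux)).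
ring.
Qed.
End Faraday.
End LocalSection.

(** * The second derivative of a twistor spinor *)

Section TwistorSpinor.
Variables (R : realType) (n : nat) (M : smooth_manifold R n).
Variables (o : M -> frame M -> Prop) (ho : orientation o).
Variables (c : set (form2 M)) (hc : conformal_class c).
Variables (cl : clifford_module R n).
Variables (Q : cspin_structure cl o c) (W : weyl_structure o c).
Variables (w : R) (psi phi : Q -> 'cV[R[i]]_(spin_dim n)).
Hypothesis psi_spinor : is_spinor w psi.
Hypothesis phi_spinor : is_spinor (w - 1) phi.
Hypothesis twistor : is_twistor W w psi phi.
Variables (U : set M) (s : M -> Q).
Hypothesis hs : local_section U s.
Local Notation "x *:: X" := (x%:C *: X) (at level 40).
Local Notation g := (gam cl).
Local Notation p := (section_frame s).
Local Notation E := (section_vf s).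
Local Notation A := (conn_mx W s).
Local Notation ps := (fun y => psi (s y)).
Local Notation fs := (fun y => phi (s y)).

Lemma nabla_spinorE (w' : R) (chi : Q -> 'cV[R[i]]_(spin_dim n)) y v :
  nabla_spinor W w' chi s y v =
  d_cmx v (fun z => chi (s z)) + spin_conn cl w' (W p y v) *m chi (s y).
Proof. by []. Qed.

Lemma smooth_psi y : U y -> smooth_cmx ps y.
Proof. by move=> Uy; exact: (psi_spinor.2 U s hs y Uy). Qed.

Lemma smooth_phi y : U y -> smooth_cmx fs y.
Proof. by move=> Uy; exact: (phi_spinor.2 U s hs y Uy). Qed.

Lemma twistor_vec y xi : U y ->
  d_cmx (vec (p y) xi) ps =
  - (n%:R^-1 *:: (clif cl xi *m fs y)) - spin_conn cl w (W p y (vec (p y) xi)) *m ps y.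
Proof.
move=> Uy; have := twistor xi hs Uy; rewrite nabla_spinorE => /eqP.
by rewrite addr_eq0 => /eqP <-; rewrite addrK.
Qed.

Lemma twistor_frame y a : U y ->
  d_cmx (E a y) ps = - (n%:R^-1 *:: (g a *m fs y)) - spin_conn cl w (A a y) *m ps y.
Proof.
by move=> Uy; have := twistor_vec (delta_mx a ord0) Uy; rewrite vec_delta clif_delta.
Qed.

Lemma smooth_d_psi a y : U y -> smooth_cmx (fun z => d_cmx (E a z) ps) y.
Proof.
move=> Uy i j; have [sr si] := smooth_psi Uy i j.
have := conj (smooth_vf hs a Uy sr) (smooth_vf hs a Uy si).
by rewrite -/(csmooth_at (fun z => dC (E a z) (fun y => ps y i j)) y);
  apply: csmooth_eq => z; rewrite d_cmxE.
Qed.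

Lemma d_twistor x d a : U x ->
  d_cmx (E d x) (fun y => d_cmx (E a y) ps) +
  (spin_conn cl w (dconn_mx W s x d a) *m ps x +
   spin_conn cl w (A a x) *m d_cmx (E d x) ps) =
  - (n%:R^-1 *:: (g a *m d_cmx (E d x) fs)).
Proof.
move=> Ux; have td := tangent_section_vf ho hs d Ux.
have sA := smooth_conn_mx W hs a Ux.
have sG : smooth_cmx (fun y => spin_conn cl w (A a y)) x by exact: smooth_spin_conn.
have sp := smooth_psi Ux; have sf := smooth_phi Ux.
have sGp := smooth_cmxM sG sp.
have <- : d_cmx (E d x) (fun y => spin_conn cl w (A a y) *m ps y) =
    spin_conn cl w (dconn_mx W s x d a) *m ps x +
    spin_conn cl w (A a x) *m d_cmx (E d x) ps.
  by rewrite (d_cmxM td sG sp) (d_spin_conn td).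
rewrite -(d_cmxD td (smooth_d_psi a Ux) sGp).
have sgf : smooth_cmx (fun y => g a *m fs y) x.
  by apply: smooth_cmxM => //; exact: smooth_cmx_cst.
transitivity (d_cmx (E d x) (fun y => (- n%:R^-1) *:: (g a *m fs y))).
  apply/esym; apply: (d_cmx_ext td).
    apply: (near_section hs Ux) => y Uy.
    by rewrite twistor_frame // subrK rmorphN scaleNr.
  by apply: smooth_cmxZ => //; exact: smooth_at_cst.
rewrite (d_cmxZ td (smooth_at_cst _ x) sgf) (tangent_cst td) scale0r add0r.
rewrite (d_cmxM td (smooth_cmx_cst _ x) sf) (d_cmx_cst td) mul0mx add0r.
by rewrite rmorphN scaleNr.
Qed.

Lemma psi_commutator x d a : U x ->
  d_cmx (E d x) (fun y => d_cmx (E a y) ps) -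
  d_cmx (E a x) (fun y => d_cmx (E d y) ps) =
  \sum_e torsion_coef (fun a => A a x) e d a *:: d_cmx (E e x) ps.
Proof.
move=> Ux; apply/matrixP=> i j; rewrite summxE.
have [sr si] := smooth_psi Ux i j.
have er := vf_commutator W hs d a Ux sr; have ei := vf_commutator W hs d a Ux si.
transitivity
  ((\sum_e torsion_coef (fun a => A a x) e d a *
     E e x (fun y => complex.Re (ps y i j))) +i*
   (\sum_e torsion_coef (fun a => A a x) e d a *
     E e x (fun y => complex.Im (ps y i j)))).
  have dd v b : dC v (fun y => d_cmx (E b y) ps i j) =
      v (fun y => E b y (fun z => complex.Re (ps z i j))) +i*
      v (fun y => E b y (fun z => complex.Im (ps z i j))).
    by rewrite /dC; congr (_ +i* _); congr v; apply/funext=> y; rewrite d_cmxE.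
  by rewrite mxD mxN !d_cmxE !dd -er -ei.
apply/eqP; rewrite eq_complex !raddf_sum /=; apply/andP; split; apply/eqP;
  by apply: eq_bigr => e _; rewrite mxZ d_cmxE /dC /= mul0r ?subr0 ?addr0.
Qed.

Section Schouten.
Hypothesis hn : (3 <= n)%N.
Variables (F B : form2 M).
Hypothesis hF : is_faraday Q W F.
Hypothesis hred : forall (q : Q) (xi : 'cV[R]_n),
  (w - 2^-1)%:C *:
    (mu_sq F psi q xi +
     ((2 * (n%:R - 1))^-1)%:C *: (clif cl xi *m mu_form F psi q)) =
  mu_sq B psi q xi.

Lemma mu_sqE (G : form2 M) y a : U y ->
  mu_sq G psi (s y) (delta_mx a ord0) =
  cvec cl (fun b => G y (E a y) (E b y)) *m psi (s y).
Proof.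
move=> Uy; rewrite /mu_sq /cvec mulmx_suml (proj_section hs Uy) vec_delta.
by apply: eq_bigr => b _; rewrite -scalemxAl.
Qed.

Lemma mu_formE y : U y -> mu_form F psi (s y) =
  quad cl (fun a b => F y (E a y) (E b y)) *m psi (s y).
Proof.
move=> Uy; rewrite /mu_form /quad mulmx_suml (proj_section hs Uy).
apply: eq_bigr => a _; rewrite mulmx_suml; apply: eq_bigr => b _.
by rewrite -scalemxAl mulmxA.
Qed.

(** The analytic data at [x] fed into the pointwise algebra: curvature symmetries,
    integrability, and the reduction hypothesis in the frame. *)
Lemma twistor_nabla_phi x d : U x -> exists y : 'I_n -> R,
  d_cmx (E d x) fs + spin_conn cl (w - 1) (A d x) *m fs x =
  cvec cl y *m psi (s x).
Proof.
move=> Ux.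
have [g0 [theta [cg lee ext]]] := hF.
pose K := section_curv W s x.
have KF a b : co_trace (K a b) = F x (E a x) (E b x).
  by rewrite (faraday_curvature ho hs (ltnW (ltnW hn)) hc cg lee ext _ _ Ux).
have Kco a b : co (K a b).
  by apply: co_curvature => *; [apply: (co_conn_mx ho W hs)|apply: (co_dconn_mx ho W hs)].
have Ksk a b : K b a = - K a b by exact: curvature_skew.
have Kb a b e f : K a b f e + K b e f a + K e a f b = 0.
  exact: (first_bianchi ho W hs a b e f Ux).
exists (twistor_schouten K (fun a b => B x (E a x) (E b x)) d).
pose nphi a := d_cmx (E a x) fs + spin_conn cl (w - 1) (A a x) *m fs x.
have integ a b : ((w * co_trace (K a b)) *:: 1%:M + spin_lift cl (K a b)) *m ps x =
    - (n%:R^-1 *:: (g b *m nphi a - g a *m nphi b)).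
  rewrite scalemx1 -/(spin_conn cl w (K a b)).
  apply: (@twistor_integrability R n cl w (fun a => A a x) (dconn_mx W s x)
    (ps x) (fs x) (fun a => d_cmx (E a x) ps) (fun a => d_cmx (E a x) fs)
    (fun a b => d_cmx (E a x) (fun y => d_cmx (E b y) ps))).
  - by move=> e; apply: (co_conn_mx ho W hs).
  - by move=> e; rewrite twistor_frame // subrK.
  - by move=> e f; exact: d_twistor.
  - by move=> e f; exact: psi_commutator.
have red a : (w - 2^-1) *:: (cvec cl (fun b => co_trace (K a b)) *m ps x +
    (2 * (n%:R - 1))^-1 *::
      (g a *m (quad cl (fun a b => co_trace (K a b)) *m ps x))) =
    cvec cl (fun b => B x (E a x) (E b x)) *m ps x.
  have -> : (fun b => co_trace (K a b)) = (fun b => F x (E a x) (E b x)).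
    by apply/funext=> b; exact: KF.
  have -> : (fun a b => co_trace (K a b)) = (fun a b => F x (E a x) (E b x)).
    by apply/funext=> a'; apply/funext=> b; exact: KF.
  rewrite -mu_sqE // -mu_sqE // -mu_formE // -hred clif_delta //.
exact: (nabla_phi_clifford Ksk Kco Kb hn integ red).
Qed.
End Schouten.
End TwistorSpinor.

(** * Parallel densities *)

Section HermitianCalculus.
Variables (R : realType) (n : nat) (M : smooth_manifold R n).
Variables (cl : clifford_module R n) (x : M).
Local Notation N := (spin_dim n).
Implicit Types (u z : M -> 'cV[R[i]]_N).

Lemma smooth_cmx_conjT z y : smooth_cmx z y ->
  smooth_cmx (fun t => (map_mx (@conjc R) (z t))^T) y.
Proof.
move=> sz i j; have := csmooth_conj (sz j i).
by apply: csmooth_eq => t; rewrite !mxE.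
Qed.

Lemma csmooth_hprod u z y : smooth_cmx u y -> smooth_cmx z y ->
  csmooth_at (fun t => hprod cl (u t) (z t)) y.
Proof.
move=> su sz; have sG := smooth_cmx_cst (herm_gram cl) y.
exact: (smooth_cmxM (smooth_cmxM (smooth_cmx_conjT sz) sG) su ord0 ord0).
Qed.

(** The Gram matrix of the hermitian product is constant. *)
Lemma dC_hprod v u z : tangent x v -> smooth_cmx u x -> smooth_cmx z x ->
  dC v (fun t => hprod cl (u t) (z t)) =
  hprod cl (d_cmx v u) (z x) + hprod cl (u x) (d_cmx v z).
Proof.
move=> tv su sz; have sG := smooth_cmx_cst (herm_gram cl) x.
have sc := smooth_cmx_conjT sz; have sH := smooth_cmxM sc sG.
rewrite -[LHS](d_cmxE v (fun t => (map_mx (@conjc R) (z t))^T *m herm_gram cl *m u t)).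
rewrite (d_cmxM tv sH su) (d_cmxM tv sc sG) (d_cmx_cst tv) mulmx0 addr0.
have -> : d_cmx v (fun t => (map_mx (@conjc R) (z t))^T) =
    (map_mx (@conjc R) (d_cmx v z))^T.
  apply/matrixP=> i j; rewrite d_cmxE 2![in RHS]mxE d_cmxE.
  rewrite -(dC_conj tv (sz j i)); congr dC; apply/funext=> t.
  by rewrite !mxE.
by rewrite mxE addrC.
Qed.

Lemma d_cmx_vec k l (e : frame M) (xi : 'cV[R]_n) (h : M -> 'M[R[i]]_(k, l)) :
  d_cmx (vec e xi) h = \sum_a (xi a ord0)%:C *: d_cmx (e a) h.
Proof.
apply/matrixP=> i j; rewrite summxE d_cmxE.
apply/eqP; rewrite eq_complex !raddf_sum /=; apply/andP; split; apply/eqP;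
  by apply: eq_bigr => a _; rewrite mxZ d_cmxE /dC /= mul0r ?subr0 ?addr0.
Qed.

Lemma Re_hprod_smooth u z y : smooth_cmx u y -> smooth_cmx z y ->
  smooth_at (fun t => complex.Re (hprod cl (u t) (z t))) y.
Proof. by move=> su sz; have [] := csmooth_hprod su sz. Qed.

Lemma d_Re_hprod v u z : tangent x v -> smooth_cmx u x -> smooth_cmx z x ->
  v (fun t => complex.Re (hprod cl (u t) (z t))) =
  complex.Re (hprod cl (d_cmx v u) (z x)) + complex.Re (hprod cl (u x) (d_cmx v z)).
Proof.
move=> tv su sz; have := congr1 (@complex.Re R) (dC_hprod tv su sz).
by rewrite raddfD.
Qed.
End HermitianCalculus.

Section Densities.
Variables (R : realType) (n : nat) (M : smooth_manifold R n).
Variables (o : M -> frame M -> Prop) (c : set (form2 M)).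
Variables (cl : clifford_module R n) (Q : cspin_structure cl o c).
Variables (w : R) (psi phi : Q -> 'cV[R[i]]_(spin_dim n)).
Hypothesis psi_spinor : is_spinor w psi.
Hypothesis phi_spinor : is_spinor (w - 1) phi.

Lemma Re_hprod_scale (a b : R) (u v : 'cV[R[i]]_(spin_dim n)) :
  complex.Re (hprod cl (a%:C *: u) (b%:C *: v)) =
  a * b * complex.Re (hprod cl u v).
Proof. by rewrite hprodZl hprodZr conjc_real !ReZ mulrA. Qed.

Lemma normsq_Spin (a : R) S u : Spin cl S ->
  normsq cl (a%:C *: (invmx S *m u)) = a * a * normsq cl u.
Proof. by move=> sS; rewrite /normsq Re_hprod_scale hprod_Spin_inv. Qed.

Lemma density_C : is_density (2 * w - 1) (twistor_C psi phi).
Proof.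
split=> [q [S t] cS|U s hs x Ux].
  have [/= sS t0] := cS; have t1 : t != 0 by rewrite gt_eqF.
  rewrite /twistor_C (psi_spinor.1 q _ cS) (phi_spinor.1 q _ cS) Re_hprod_scale.
  rewrite (hprod_Spin_inv _ _ sS); congr (_ * _).
  rewrite -powRD; last by rewrite t1 implybT.
  by congr (_ `^ _); ring.
apply: Re_hprod_smooth; first exact: (psi_spinor.2 U s hs x Ux).
exact: (phi_spinor.2 U s hs x Ux).
Qed.

(** The squared norms are invariant under Spin(n) one by one, the sum of squares only
    as a whole. *)
Lemma density_Q : is_density (4 * w - 2) (twistor_Q psi phi).
Proof.
split=> [q [S t] cS|U s hs x Ux].
  have [/= sS t0] := cS; have t1 : t != 0 by rewrite gt_eqF.
  have tD a b : t `^ a * t `^ b = t `^ (a + b).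
    by rewrite powRD // t1 implybT.
  rewrite /twistor_Q (psi_spinor.1 q _ cS) (phi_spinor.1 q _ cS) /=.
  rewrite !(normsq_Spin _ _ sS).
  under eq_bigr => i _ do rewrite -scalemxAr Re_hprod_scale exprMn.
  rewrite -mulr_sumr (pairing_Spin_invariant _ _ sS) mulrBr.
  congr (_ - _ * _).
    by rewrite mulrACA !tD; congr (_ `^ _ * _); ring.
  by rewrite expr2 !tD; congr (_ `^ _); ring.
have sp := psi_spinor.2 U s hs x Ux; have sf := phi_spinor.2 U s hs x Ux.
have spp := Re_hprod_smooth cl sp sp; have sff := Re_hprod_smooth cl sf sf.
apply: (smooth_atB (smooth_atM spp sff)).
apply: smooth_at_sum => i _; under eq_fun do rewrite expr2.
have sg : smooth_cmx (fun y => gam cl i *m psi (s y)) x.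
  by apply: smooth_cmxM => //; exact: smooth_cmx_cst.
have spf := Re_hprod_smooth cl sf sg.
exact: (smooth_atM spf spf).
Qed.
End Densities.

Theorem theorem3p6 (R : realType) (n : nat) (hn : (3 <= n)%N)
  (M : smooth_manifold R n) (o : M -> frame M -> Prop) (ho : orientation o)
  (c : set (form2 M)) (hc : conformal_class c)
  (cl : clifford_module R n) (Q : cspin_structure cl o c)
  (W : weyl_structure o c)
  (F : form2 M) (hF : is_faraday Q W F)
  (w : R) (psi Dpsi : Q -> 'cV[R[i]]_(spin_dim n))
  (hpsi : is_spinor w psi) (hDpsi : is_dirac W w psi Dpsi)
  (htwistor : is_twistor W w psi Dpsi)
  (B : form2 M) (hB : bilinear_section B)
  (hred : forall (q : Q) (xi : 'cV[R]_n),
     (w - 2^-1)%:C *: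
       (mu_sq F psi q xi +
        ((2 * (n%:R - 1))^-1)%:C *: (clif cl xi *m mu_form F psi q)) =
     mu_sq B psi q xi) :
  parallel_density W (2 * w - 1) (twistor_C psi Dpsi) /\
  parallel_density W (4 * w - 2) (twistor_Q psi Dpsi).
Proof.
have [hphi _] := hDpsi.
pose ip (u v : 'cV[R[i]]_(spin_dim n)) := complex.Re (hprod cl u v).
have ipC u v : ip u v = ip v u by exact: Re_hprodC.
have ipDl u u' v : ip (u + u') v = ip u v + ip u' v.
  by rewrite /ip hprodDl raddfD.
have ipZl t u v : ip (t%:C *: u) v = t * ip u v by rewrite /ip hprodZl ReZ.
have ip_gam a u v : ip (gam cl a *m u) v = - ip u (gam cl a *m v).
  by rewrite /ip gam_skew raddfN.
(* The twistor equation and its consequence for phi, along an arbitrary tangent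
   vector: expand it in the frame. *)
have derivatives U s x v : local_section U s -> U x -> tangent x v ->
    exists xi eta : 'I_n -> R,
    let A := W (fun y => fr (s y)) x v in
    [/\ co A,
      d_cmx v (fun y => psi (s y)) =
        - ((n%:R^-1)%:C *: (cvec cl xi *m Dpsi (s x)))
        - spin_conn cl w A *m psi (s x) &
      d_cmx v (fun y => Dpsi (s y)) =
        cvec cl eta *m psi (s x) - spin_conn cl (w - 1) A *m Dpsi (s x)].
  move=> hs Ux tv.
  have [_ /(_ v tv) [xi [vE _]]] := section_frameP ho hs Ux.
  have /choice [eta etaE] := fun d =>
    twistor_nabla_phi ho hc hpsi hphi htwistor hs hn hF hred d Ux.
  exists (fun a => xi a ord0), (fun b => \sum_a xi a ord0 * eta a b).
  split; first exact: (co_conn W hs Ux tv).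
    by rewrite vE; exact: (twistor_vec htwistor hs xi Ux).
  rewrite vE (conn_vec ho W hs xi Ux) spin_conn_sum.
  have -> : cvec cl (fun b => \sum_a xi a ord0 * eta a b) =
      \sum_a (xi a ord0)%:C *: cvec cl (eta a).
    rewrite /cvec; under [RHS]eq_bigr => a _ do rewrite scaler_sumr.
    rewrite exchange_big; apply: eq_bigr => b _ /=.
    rewrite rmorph_sum scaler_suml; apply: eq_bigr => a _.
    by rewrite scalerA -rmorphM.
  rewrite d_cmx_vec !mulmx_suml -sumrB; apply: eq_bigr => a _.
  rewrite spin_connZ -!scalemxAl -scalerBr; congr (_ *: _).
  by rewrite -etaE addrK.
split; split; [exact: density_C| |exact: density_Q|] => U s x v hs Ux tv.
- have sp := smooth_psi hpsi hs Ux; have sf := smooth_phi hphi hs Ux.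
  have [xi [eta /= [cA dp df]]] := derivatives U s x v hs Ux tv.
  rewrite /nabla_density /twistor_C (d_Re_hprod cl tv sp sf).
  exact: (parallel_C ipC ipDl ipZl ip_gam dp df).
have sp := smooth_psi hpsi hs Ux; have sf := smooth_phi hphi hs Ux.
have [xi [eta /= [cA dp df]]] := derivatives U s x v hs Ux tv.
have sg i : smooth_cmx (fun y => gam cl i *m psi (s y)) x.
  by apply: smooth_cmxM => //; exact: smooth_cmx_cst.
have dg i : d_cmx v (fun y => gam cl i *m psi (s y)) =
    gam cl i *m d_cmx v (fun y => psi (s y)).
  by rewrite (d_cmxM tv (smooth_cmx_cst _ x) sp) (d_cmx_cst tv) mul0mx add0r.
have spp := Re_hprod_smooth cl sp sp; have sff := Re_hprod_smooth cl sf sf.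
have spf i := Re_hprod_smooth cl sf (sg i).
have sq i := smooth_atM (spf i) (spf i).
rewrite -(parallel_Q ipC ipDl ipZl ip_gam cA dp df) /nabla_density.
congr (_ + _); rewrite /twistor_Q /normsq.
under eq_fun => y do under eq_bigr => i _ do rewrite expr2.
rewrite (tangentB tv); [|exact: smooth_atM|exact: smooth_at_sum].
rewrite (tangentM tv) // (d_Re_hprod cl tv sp sp) (d_Re_hprod cl tv sf sf).
congr (_ - _); rewrite (tangent_sum tv) //; apply: eq_bigr => i _.
rewrite (tangentM tv (spf i) (spf i)) (d_Re_hprod cl tv sf (sg i)) dg.
by rewrite mulrC mulr_natl mulr2n.
Qed.
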